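(* Let $\mu$ be the uniform distribution on $[0,1]$. For each integer $n\ge1$ let $\mathrm{wce}(n)$ be the worst-case error in $H^1(0,1)$ of the Poincaré quadrature of $H^1(0,1)$ with $n$ nodes, and let $r(n)=\inf_{X,w}\mathrm{wce}(X,w,H^1(0,1))$ be the radius of information, the infimum being over all quadratures with $n$ nodes. Then the Poincaré quadrature is asymptotically optimal for $H^1(0,1)$: $$\frac{\mathrm{wce}(n)}{r(n)}\;\longrightarrow\;1\qquad\text{as } n\to\infty.$$
   Context: $H^1(0,1)=\{f\in L^2(0,1): f'\in L^2(0,1)\}$ (weak derivatives; elements identified with their continuous representatives), with norm $\|f\|_{H^1(0,1)}^2=\int_0^1 f(x)^2dx+\int_0^1 f'(x)^2dx$. A quadrature with $n$ nodes is a pair $(X,w)$ with $X=(x_1,\dots,x_n)\in[0,1]^n$ and $w=(w_1,\dots,w_n)\in\mathbb{R}^n$ (weights not constrained), and $$\mathrm{wce}(X,w,H^1(0,1))=\sup\left\{\left|\int_0^1 h(x)\,dx-\sum_{i=1}^n w_ih(x_i)\right|: h\in H^1(0,1),\ \|h\|_{H^1(0,1)}\le1\right\}.$$ The Poincaré basis of the uniform distribution on $[0,1]$ is $\varphi_0=1$, $\varphi_m(x)=\sqrt2\cos(m\pi x)$ for $m\ge1$. The Poincaré quadrature $(X_P,w_P)$ with $n$ nodes is the unique quadrature with $n$ nodes and positive weights that integrates $\varphi_0,\dots,\varphi_{2n-1}$ exactly with respect to $dx$ on $[0,1]$ (existence and uniqueness are known because the Poincaré basis is, up to signs, a Tchebytchev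 system), and $\mathrm{wce}(n)=\mathrm{wce}(X_P,w_P,H^1(0,1))$. *)

(* Defs.v *)
From HB Require Import structures.
From mathcomp Require Import all_boot all_order all_algebra.
From mathcomp Require Import all_classical all_reals all_analysis.

Set Implicit Arguments.
Unset Strict Implicit.
Unset Printing Implicit Defensive.

Import Order.TTheory GRing.Theory Num.Theory.
Import numFieldNormedType.Exports.

Local Open Scope classical_set_scope.
Local Open Scope ring_scope.

(* Functions on (0,1) are represented by functions R -> R whose values outside
   [0,1] are irrelevant.  Integrals over (0,1) are taken over [0,1], the
   endpoints being Lebesgue-null. *)

Definition square_integrable (R : realType) (f : R -> R) : Prop :=
  measurable_fun (`[0, 1] : set R) f /\
  (@lebesgue_measure R).-integrable `[0, 1] (fun x => (f x ^+ 2)%:E).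

(* C_c^oo(0,1): the support lies in some [a, b] with 0 < a and b < 1. *)
Definition test_function (R : realType) (phi : R -> R) : Prop :=
  (forall (k : nat) (x : R), derivable (phi^`(k))%classic x 1) /\
  (exists a b : R, [/\ 0 < a, b < 1 &
     forall x, phi x != 0 -> a <= x <= b]).

Definition weak_derivative (R : realType) (f g : R -> R) : Prop :=
  forall phi : R -> R, test_function phi ->
    \int[@lebesgue_measure R]_(x in `[0, 1]) (f x * (phi^`())%classic x) =
    - \int[@lebesgue_measure R]_(x in `[0, 1]) (g x * phi x).

(* [H1 h g]: h is (the continuous representative of) an element of H^1(0,1)
   and g is a version of its weak derivative h'.  As h' is unique almost
   everywhere, the value of [H1_norm h g] does not depend on the version. *)
Definition H1 (R : realType) (h g : R -> R) : Prop :=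
  [/\ {within `[0, 1], continuous h}, square_integrable h,
      square_integrable g & weak_derivative h g].

Definition H1_norm (R : realType) (h g : R -> R) : R :=
  Num.sqrt (\int[@lebesgue_measure R]_(x in `[0, 1]) (h x ^+ 2) +
            \int[@lebesgue_measure R]_(x in `[0, 1]) (g x ^+ 2)).

Definition nodes01 (R : realType) (n : nat) (X : 'I_n -> R) : Prop :=
  forall i, 0 <= X i <= 1.

Definition wce (R : realType) (n : nat) (X w : 'I_n -> R) : \bar R :=
  ereal_sup [set (`| \int[@lebesgue_measure R]_(x in `[0, 1]) h x
                     - \sum_(i < n) w i * h (X i) |)%:E |
             h in [set h : R -> R | exists2 g, H1 h g & H1_norm h g <= 1]].

Definition radius_of_information (R : realType) (n : nat) : \bar R :=
  ereal_inf [set e | exists X w : 'I_n -> R, nodes01 X /\ e = wce X w].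

Definition poincare_basis (R : realType) (m : nat) (x : R) : R :=
  if m == 0%N then 1 else Num.sqrt 2 * cos (m%:R * pi * x).

(* This determines (X, w) up to a simultaneous reordering of the nodes and
   weights, under which [wce] is invariant. *)
Definition poincare_quadrature (R : realType) (n : nat) (X w : 'I_n -> R)
    : Prop :=
  [/\ nodes01 X, (forall i, 0 < w i) &
      forall m, (m < 2 * n)%N ->
        \sum_(i < n) w i * poincare_basis m (X i) =
        \int[@lebesgue_measure R]_(x in `[0, 1]) poincare_basis m x].

(* Main.v *)
Require Import Defs.
From HB Require Import structures.
From mathcomp Require Import all_boot all_order all_algebra.
From mathcomp Require Import all_classical all_reals all_analysis.
From mathcomp Require Import measurable_realfun.
From mathcomp Require Import ring lra zify.
Import Order.TTheory GRing.Theory Num.Theory.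
Import numFieldNormedType.Exports.
Local Open Scope classical_set_scope.
Local Open Scope ring_scope.

(** Both [wce (X n) (w n)] and the radius of information are squeezed between
    explicit numbers with squares equal to 1 / (12 n^2) up to a factor
    1 - 1 / (10 n^2), so their ratio tends to 1.

    Upper bound.  Substituting t = pi x turns the Poincaré basis into the
    Chebyshev polynomials in cos t, and an n-point positive quadrature exact up
    to index 2n - 1 is then the Gauss rule: its nodes are the zeros of
    cos (n pi x), that is the n midpoints (2k + 1) / (2n), and its weights are
    1 / n ([poincare_quadrature_midpoint]).  For h in H^1 and p in (0, 1) one has
    the Peano formula
    [int h - h p = - int (x - 1_(p < x)) h' x dx]
    ([peano_point_evaluation]), so the error of a quadrature whose weights sum
    to 1 is the inner product of h' with a kernel K.  By Cauchy-Schwarz the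
    worst-case error is at most the L^2 norm of K, and for the midpoint rule
    int K^2 = 1 / (12 n^2) ([wce_poincare_le]).

    The weak derivative is only tested against smooth functions with compact
    support, so the Peano formula is obtained from test functions whose
    derivative is a smoothed indicator of (0, 1) minus a mollifier at p.  Both
    lie in the algebra generated by the functions x^(-k) exp (-1 / x), extended
    by 0 to x <= 0 and composed with affine maps, which is closed under
    differentiation ([flat_algebra_smooth]).

    Lower bound.  Let h be a function vanishing at all nodes.  Its error is its
    integral A, and if N is its squared norm, then A^2 / N >= 2 A - N, the last
    quantity being its energy.  Take for h the sum of one parabola for each gap
    between consecutive nodes; the two outer gaps are reflected at 0 and 1, which
    gives half parabolas there.  A gap of length d contributes
    (d^3 - d^5 / 10) / 12, a function that lies above its tangent at d = 1 / n
    for d <= 2.  Summing the tangent inequalities (with weight 1/2 for the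
    reflected gaps) bounds the energy below by (1 - 1 / (10 n^2)) / (12 n^2)
    whatever the nodes are ([wce_lower_bound]). *)

(** * Gauss quadrature at the Chebyshev nodes *)

Section GaussChebyshev.
Variables (R : realType) (n : nat) (t w : 'I_n -> R).
Hypothesis n0 : (0 < n)%N.
Hypothesis w_exact : forall m, (m < 2 * n)%N ->
  \sum_(i < n) w i * cos (m%:R * t i) = (m == 0%N)%:R.

(** The product of two cosines is a sum of two cosines of index a + b and a - b,
    both within the range where the quadrature is exact. *)
Lemma discrete_orthogonality (a b : nat) : (a + b < 2 * n)%N ->
  \sum_(i < n) w i * (cos (a%:R * t i) * cos (b%:R * t i)) =
  2^-1 * ((a + b == 0)%N%:R + (a == b)%:R).
Proof.
wlog ba : a b / (b <= a)%N => [H abn|abn].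
  have [/H->//|/ltnW/H H'] := leqP b a.
  rewrite addnC [a == b]eq_sym -H'; last by rewrite addnC.
  by apply: eq_bigr => i _; rewrite [cos _ * cos _]mulrC.
have a_b : (a - b < 2 * n)%N by lia.
rewrite -[(a + b == 0)%N%:R]w_exact// -(_ : (a - b == 0)%N%:R = (a == b)%:R :> R); last first.
  by congr (_ %:R); lia.
rewrite -w_exact// -big_split/= mulr_sumr; apply: eq_bigr => i _.
rewrite natrD natrB// mulrDl mulrBl cosD cosB; by field.
Qed.

(* Discrete orthogonality for a, b < n says that B is a right inverse of the
   square matrix M; it is then also a left inverse, which separates the nodes,
   determines the weights and makes the kernel of M trivial. *)
Let M := \matrix_(a < n, i < n) cos (a%:R * t i).
Let B := \matrix_(i < n, a < n)
  (w i * cos (a%:R * t i) * (if a == 0%N :> nat then 1 else 2)).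

Let MB : M *m B = 1%:M.
Proof.
apply/matrixP => a b; rewrite !mxE.
under eq_bigr => i _ do rewrite !mxE.
transitivity (\sum_(i < n) w i * (cos (a%:R * t i) * cos (b%:R * t i)) *
   (if b == 0%N :> nat then 1 else 2)).
  by apply: eq_bigr => i _; ring.
rewrite -mulr_suml discrete_orthogonality; last first.
  by have := ltn_ord a; have := ltn_ord b; lia.
rewrite -val_eqE/=.
have [b0|b0] := eqVneq (b : nat) 0%N; first by rewrite b0 addn0; by field.
rewrite addn_eq0 (negbTE b0) andbF add0r; by field.
Qed.

Lemma exact_quadrature_inj : injective t.
Proof.
move=> i j tij; have BM : B *m M = 1%:M by exact: mulmx1C.
have : (B *m M) i i = (B *m M) i j.
  by rewrite !mxE; apply: eq_bigr => a _; rewrite !mxE tij.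
rewrite BM !mxE eqxx; case: (eqVneq i j) => // _ /eqP.
by rewrite oner_eq0.
Qed.

Hypothesis w0 : forall i, 0 < w i.

(** Index n is still orthogonal to all indices below n, so the column vector
    w_i cos (n t_i) lies in the kernel of the invertible matrix M. *)
Lemma exact_quadrature_nodes i : cos (n%:R * t i) = 0.
Proof.
pose v := \col_(i < n) (w i * cos (n%:R * t i)).
have Mv : M *m v = 0.
  apply/colP => a; rewrite !mxE.
  under eq_bigr => k _ do rewrite !mxE mulrCA.
  rewrite discrete_orthogonality; last by have := ltn_ord a; lia.
  have -> : ((a + n == 0) = false)%N by lia.
  have -> : ((a : nat) == n) = false by have := ltn_ord a; lia.
  by rewrite addr0 mulr0.
have : (v i 0 = 0).
  have BM : B *m M = 1%:M by exact: mulmx1C.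
  by rewrite -[v]mul1mx -BM -mulmxA Mv mulmx0 mxE.
by rewrite mxE => /eqP; rewrite mulf_eq0 (gt_eqF (w0 i))/= => /eqP.
Qed.

(* Summation of 1 + 2 (cos^2 x + ... + cos^2 (m x)) by
   2 cos^2 (a x) = 1 + cos (2 a x) and
   2 sin x cos (2 a x) = sin ((2 a + 1) x) - sin ((2 a - 1) x). *)
Let telescope (x : R) m :
  sin x *+ 2 * (\sum_(a < m.+1) cos (a%:R * x) * cos (a%:R * x) *
     (if a == 0%N :> nat then 1 else 2)) =
  sin x *+ (m.+1 * 2) + (sin ((m * 2).+1%:R * x) - sin x).
Proof.
elim: m => [|m IH].
  by rewrite big_ord_recr big_ord0/= add0r mul0r cos0 !mul1r mulr1 subrr addr0.
rewrite big_ord_recr/= mulrDr IH.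
have -> : (m.+1 * 2).+1%:R * x = (m.+1 * 2)%:R * x + x.
  by rewrite -addn1 natrD; ring.
have -> : (m * 2).+1%:R * x = (m.+1 * 2)%:R * x - x.
  by rewrite mulSn -[(m * 2).+1]addn1 !natrD; ring.
have -> : (m.+1 * 2)%:R * x = m.+1%:R * x + m.+1%:R * x by rewrite natrM; ring.
rewrite sinB !sinD !cosD.
have /eqP := sin2cos2 (m.+1%:R * x); rewrite expr2 => /eqP ->.
rewrite [(_ * 2)%N in RHS]mulSn mulrnDr; ring.
Qed.

(** The diagonal of B M = 1 reads w_i (1 + 2 sum_(0 < a < n) cos^2 (a t_i)) = 1,
    and the bracket equals n because cos (n t_i) = 0. *)
Lemma exact_quadrature_weights i : w i = n%:R^-1.
Proof.
have BM : B *m M = 1%:M by exact: mulmx1C.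
have /matrixP/(_ i i) := BM; rewrite !mxE eqxx.
under eq_bigr => a _ do rewrite !mxE.
have ctn := exact_quadrature_nodes i.
move: n0 ctn; case: (n) w t i => // m w' t' i _ ctn h.
have {}h : w' i * (\sum_(a < m.+1) cos (a%:R * t' i) * cos (a%:R * t' i) *
     (if a == 0%N :> nat then 1 else 2)) = 1.
  by rewrite -[RHS]h mulr_sumr; apply: eq_bigr => a _; ring.
have s0 : sin (t' i) != 0.
  apply/eqP => s0; have sk k : sin (k%:R * t' i) = 0.
    elim: k => [|k IH]; first by rewrite mul0r sin0.
    by rewrite -addn1 natrD mulrDl mul1r sinD IH s0 mul0r mulr0 addr0.
  have := cos2Dsin2 (m.+1%:R * t' i); rewrite ctn sk !expr0n/= addr0 => /eqP.
  by rewrite eq_sym oner_eq0.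
have := telescope (t' i) m.
have -> : sin ((m * 2).+1%:R * t' i) = sin (t' i).
  have -> : (m * 2).+1%:R * t' i = (m.+1%:R * t' i + m.+1%:R * t' i) - t' i.
    by rewrite -addn1 natrD natrM -[m.+1]addn1 natrD; ring.
  rewrite sinB sinD cosD ctn.
  have := cos2Dsin2 (m.+1%:R * t' i); rewrite ctn expr0n/= add0r expr2 => ->.
  ring.
rewrite subrr addr0 mulrnA -[in RHS]mulrnAC -[in RHS]mulr_natr => /mulfI h2.
have {}h2 : \sum_(a < m.+1) cos (a%:R * t' i) * cos (a%:R * t' i) *
     (if a == 0%N :> nat then 1 else 2) = m.+1%:R.
  by apply: h2; rewrite mulrn_eq0.
have nz : m.+1%:R != 0 :> R by rewrite pnatr_eq0.
have hw : w' i * m.+1%:R = 1 by rewrite -h2.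
by rewrite -[LHS](mulfK nz) hw mul1r.
Qed.
End GaussChebyshev.

Lemma cosDnatpi (R : realType) (k : nat) (x : R) : cos (x + k%:R * pi) = (-1) ^+ k * cos x.
Proof.
elim: k => [|k IH]; first by rewrite mul0r addr0 mul1r.
by rewrite -addn1 natrD mulrDl mul1r addrA cosDpi IH exprD expr1; ring.
Qed.

Lemma cos_natpi_zero (R : realType) (n : nat) (x : R) : (0 < n)%N -> 0 <= x <= 1 ->
  cos (n%:R * (pi * x)) = 0 -> exists k : 'I_n, x = (k.*2.+1)%:R / (n.*2)%:R.
Proof.
move=> n0 /andP[x0 x1] c0.
set y := n%:R * x.
have y0 : 0 <= y by rewrite mulr_ge0.
set k := Num.truncn y.
have /andP[ky yk] : k%:R <= y < k.+1%:R by exact: truncn_itv.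
have pi0 := pi_gt0 R.
have yz : y = k%:R + 2^-1.
  have : cos (pi * (y - k%:R)) = cos (pi / 2).
    rewrite cos_pihalf; have : cos (pi * (y - k%:R) + k%:R * pi) = 0.
      by rewrite -[RHS]c0; congr cos; rewrite /y; ring.
    by rewrite cosDnatpi => /eqP; rewrite mulf_eq0 signr_eq0 => /eqP.
  move=> hc; have /(mulfI (lt0r_neq0 pi0)) : pi * (y - k%:R) = pi / 2.
    apply: cos_inj hc; rewrite in_itv/=; last by lra.
    rewrite mulr_ge0 ?subr_ge0 ?pi_ge0//= -[leRHS]mulr1 ler_pM2l//.
    by rewrite lerBlDl -[1]/(1%:R) -natrD addn1 ltW.
  by move=> /eqP; rewrite subr_eq => /eqP->; rewrite addrC.
have kn : (k < n)%N.
  rewrite -(ltr_nat R); apply: (@lt_le_trans _ _ y); first by rewrite yz ltrDl invr_gt0.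
  by rewrite /y -[leRHS]mulr1 ler_pM2l ?ltr0n.
exists (Ordinal kn) => /=.
have nR : n%:R != 0 :> R by rewrite pnatr_eq0 -lt0n.
have -> : x = y / n%:R by rewrite /y mulrAC divff// mul1r.
rewrite yz -!muln2 -addn1 natrD !natrM; by field.
Qed.

(** * Flat functions *)

Section Smooth.
Variable R : realType.
Implicit Types (f g : R -> R) (x y : R) (k : nat).

Definition flat k x : R := if 0 < x then x^-1 ^+ k * expR (- x^-1) else 0.

(** Comparison of the exponential with its term of degree k + 2. *)
Lemma flat_quadratic k x : `|flat k x| <= (k.+2)`!%:R * x ^+ 2.
Proof.
rewrite /flat; case: ifPn => x0; last first.
  by rewrite normr0 mulr_ge0// sqr_ge0.
rewrite ger0_norm; last by rewrite mulr_ge0 ?exprn_ge0 ?expR_ge0 ?invr_ge0 ?ltW.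
rewrite expRN ler_pdivrMr ?expR_gt0//.
have := @expR_ge1Dxn R x^-1 k.+1; rewrite invr_ge0 (ltW x0) => /(_ isT) h.
have f0 : 0 < (k.+2)`!%:R :> R by rewrite ltr0n fact_gt0.
have {}h : x^-1 ^+ k.+2 / (k.+2)`!%:R <= expR x^-1.
  by apply: le_trans h; rewrite lerDr.
have -> : x^-1 ^+ k = x^-1 ^+ k.+2 / (k.+2)`!%:R * ((k.+2)`!%:R * x ^+ 2).
  rewrite !exprSr; set z := _ ^+ k; field.
  by rewrite gt_eqF//= gt_eqF.
by rewrite mulrC ler_pM2l// mulr_gt0// exprn_gt0.
Qed.

Lemma quadratic_is_derive f C : (forall x, `|f x| <= C * x ^+ 2) -> is_derive (0:R) (1:R) f (0:R).
Proof.
move=> fC.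
have f0 : f 0 = 0.
  by apply/eqP; rewrite -normr_le0; have := fC 0; rewrite expr0n/= mulr0.
have h : h^-1 *: (f (h *: 1 + 0) - f 0) @[h --> 0^'] --> 0.
  apply/norm_cvg0P.
  apply: (@squeeze_cvgr _ _ _ _ (cst 0) (fun h => `|C| * `|h|)).
  - near=> h; rewrite normr_ge0/= f0 subr0 addr0 normrZ normfV scaler1.
    have h0 : 0 < `|h| by rewrite normr_gt0; near: h; exact: nbhs_dnbhs_neq.
    rewrite ler_pdivrMl// (le_trans (fC _))// (le_trans (ler_norm _))//.
    rewrite normrM normrX expr2.
    have -> : `|h| * (`|C| * `|h|) = `|C| * (`|h| * `|h|) by ring.
    exact: lexx.
  - exact: cvg_cst.
  - rewrite -[X in _ --> X](mulr0 `|C|); apply: cvgM; first exact: cvg_cst.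
    rewrite -[X in _ --> X](@normr0 _ R); apply: cvg_norm.
    exact: (@cvg_within _ (nbhs (0:R))).
apply: DeriveDef; first by apply/cvg_ex; exists 0.
exact/cvg_lim.
Unshelve. all: by end_near. Qed.

Lemma is_derive_flat k x :
  is_derive x 1 (flat k) (flat k.+2 x - k%:R * flat k.+1 x).
Proof.
have [x0|x0|->] := ltgtP x 0.
- rewrite /flat (lt_gtF x0) mulr0 subr0.
  apply: (near_eq_is_derive _ (@is_derive_cst _ _ _ 0 x 1)).
  near=> y; have : y < 0 by near: y; exact: lt_nbhsl.
  by move=> y0; rewrite (lt_gtF y0).
- rewrite /flat x0.
  have xn : x != 0 by rewrite gt_eqF.
  have h : is_derive x 1 (fun y => y^-1 ^+ k * expR (- y^-1))
      (x^-1 ^+ k.+2 * expR (- x^-1) - k%:R * (x^-1 ^+ k.+1 * expR (- x^-1))).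
    have dV : is_derive x 1 (fun y : R => y^-1) (- x ^- 2 *: 1) by exact: is_deriveV.
    have dE : is_derive x 1 (fun y : R => expR (- y^-1))
        (expR (- x^-1) * (- (- x ^- 2 *: 1))).
      apply: (@is_derive1_comp _ expR (fun y : R => - y^-1)).
    have dX := @is_deriveX _ _ _ k x 1 _ dV.
    have -> : (fun y : R => y^-1 ^+ k * expR (- y^-1)) = (fun y : R => y^-1) ^+ k * (fun y : R => expR (- y^-1)).
      by apply/funext => y; rewrite !fctE.
    apply: (is_derive_eq (is_deriveM dX dE)); rewrite exprfctE.
    rewrite /GRing.scale/= -[x ^- 2]exprVn.
    case: k {dX} => [|k]; rewrite /= ?expr0n/= ?mulr0n ?mul0r ?expr0; first by ring.
    by rewrite !exprSr -mulr_natl; ring.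
  apply: near_eq_is_derive h; near=> y.
  by have -> : 0 < y by near: y; exact: lt_nbhsr.
- rewrite [X in is_derive _ _ _ X](_ : _ = 0); last first.
    by rewrite /flat ltxx mulr0 subr0.
  exact: quadratic_is_derive (flat_quadratic k).
Unshelve. all: by end_near. Qed.

(** Closing the flat functions under affine substitution, linear combinations
    and products gives a class that is stable under differentiation; smoothness
    of its members follows without computing any higher derivative. *)
Inductive flat_algebra : (R -> R) -> Prop :=
| flat_affine k (a b : R) : flat_algebra (fun x => flat k (a * x + b))
| flatD f g : flat_algebra f -> flat_algebra g -> flat_algebra (fun x => f x + g x)
| flatZ (c : R) f : flat_algebra f -> flat_algebra (fun x => c * f x)
| flatM f g : flat_algebra f -> flat_algebra g -> flat_algebra (fun x => f x * g x).

Lemma flat_algebra_is_derive f : flat_algebra f ->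
  exists2 g, flat_algebra g & forall x, is_derive x 1 f (g x).
Proof.
elim=> {f} [k a b|f g _ [f' Cf' df] _ [g' Cg' dg]|c f _ [f' Cf' df]|
    f g Cf [f' Cf' df] Cg [g' Cg' dg]].
- exists (fun x => a * (flat k.+2 (a * x + b) + - k%:R * flat k.+1 (a * x + b))).
    by do 2 constructor; first constructor; do 2 constructor.
  move=> x.
  have d1 : is_derive x 1 (fun y : R => a * y + b) (a * 1).
    by apply: is_derive_eq; rewrite ?addr0//.
  have d2 := is_derive_flat k (a * x + b).
  apply: (is_derive_eq (@is_derive1_comp _ (flat k) (fun y : R => a * y + b) x _ _ d2 d1)).
  by ring.
- exists (fun x => f' x + g' x) => [|x]; first by constructor.
  exact: is_deriveD.
- exists (fun x => c * f' x) => [|x]; first by constructor.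
  by apply: is_deriveZ.
- exists (fun x => f x * g' x + g x * f' x) => [|x].
    by constructor; constructor.
  exact: is_deriveM.
Qed.

Lemma flat_algebra_smooth f k x : flat_algebra f -> derivable (f^`(k))%classic x 1.
Proof.
move=> Cf; suff [g Cg ->] : exists2 g, flat_algebra g & (f^`(k))%classic = g.
  have [g' _ /(_ x) dg] := flat_algebra_is_derive _ Cg.
  exact: (@ex_derive _ _ _ _ _ _ _ dg).
elim: k => [|k [g Cg IH]]; first by exists f.
have [g' Cg' dg] := flat_algebra_is_derive _ Cg.
exists g' => //; rewrite derive1nS IH; apply/funext => y.
by rewrite derive1E; exact: (@derive_val _ _ _ _ _ _ _ (dg y)).
Qed.

Lemma is_derive_continuous (f f' : R -> R) : (forall x : R, is_derive x 1 f (f' x)) ->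
  continuous f.
Proof.
move=> df x; apply: differentiable_continuous; apply/derivable1_diffP.
exact: (@ex_derive _ _ _ _ _ _ _ (df x)).
Qed.

Lemma flat_algebra_continuous f : flat_algebra f -> continuous f.
Proof.
by move=> Cf; have [g _] := flat_algebra_is_derive _ Cf; exact: is_derive_continuous.
Qed.

End Smooth.

(** * Integrals over an interval, and test functions as primitives *)

Section Integration.
Variable R : realType.
Notation mu := (@lebesgue_measure R).
Implicit Types (f g h : R -> R) (a b x : R) (D : set R).

Lemma lebesgue_measure_itvcc_lty a b : (mu `[a, b] < +oo)%E.
Proof.
rewrite lebesgue_measure_itv/=; case: ifP => _; last by rewrite ltry.
by rewrite -EFinD ltry.
Qed.

Lemma bounded_integrable_itv f a b (M : R) : measurable_fun `[a, b] f ->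
  (forall x, a <= x <= b -> `|f x| <= M) -> mu.-integrable `[a, b] (EFin \o f).
Proof.
move=> mf fM; apply: measurable_bounded_integrable => //.
  exact: lebesgue_measure_itvcc_lty.
exists M; split; first exact: num_real.
by move=> y My x /=; rewrite in_itv/= => /fM/le_trans; apply; exact: ltW.
Qed.

Lemma bounded_integrableM D f g (M : R) : measurable D -> measurable_fun D f ->
  (forall x, D x -> `|f x| <= M) -> mu.-integrable D (EFin \o g) ->
  mu.-integrable D (EFin \o (fun x => f x * g x)).
Proof.
move=> mD mf fM ig.
have -> : EFin \o (fun x => f x * g x) = ((EFin \o f) \* (EFin \o g))%E.
  by apply/funext => x /=; rewrite EFinM.
apply: (@integrableMr _ _ _ mu D mD f (EFin \o g) mf _ ig); exists M; split; first exact: num_real.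
by move=> y My x /= /fM/le_trans; apply; exact: ltW.
Qed.

Lemma EFin_integrableD D f g : measurable D -> mu.-integrable D (EFin \o f) ->
  mu.-integrable D (EFin \o g) -> mu.-integrable D (EFin \o (fun x => f x + g x)).
Proof. by move=> mD i1 i2; exact: (@integrableD _ _ _ mu D mD _ _ i1 i2). Qed.

Lemma EFin_integrableB D f g : measurable D -> mu.-integrable D (EFin \o f) ->
  mu.-integrable D (EFin \o g) -> mu.-integrable D (EFin \o (fun x => f x - g x)).
Proof. by move=> mD i1 i2; exact: (@integrableB _ _ _ mu D mD _ _ i1 i2). Qed.

Lemma EFin_integrableZ D f (k : R) : measurable D -> mu.-integrable D (EFin \o f) ->
  mu.-integrable D (EFin \o (fun x => k * f x)).
Proof. by move=> mD i1; exact: (@integrableZl _ _ _ mu D mD k _ i1). Qed.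

Lemma dominated_cvg_Rintegral D (f_ : nat -> R -> R) f g : measurable D ->
  (forall n, measurable_fun D (f_ n)) -> measurable_fun D f ->
  mu.-integrable D (EFin \o g) ->
  (forall n x, D x -> `|f_ n x| <= g x) ->
  {ae mu, forall x, D x -> f_ n x @[n --> \oo] --> f x} ->
  \int[mu]_(x in D) f_ n x @[n --> \oo] --> \int[mu]_(x in D) f x.
Proof.
move=> mD mf_ mf ig fg ff.
have := @dominated_convergence _ _ _ mu D mD
  (fun n => EFin \o f_ n) (EFin \o f) (EFin \o g).
case.
- by move=> n; apply/measurable_EFinP; exact: mf_.
- by apply/measurable_EFinP; exact: mf.
- apply: (@filterS _ _ (ae_filter_ringOfSetsType mu) _ _ _ ff) => x ffx Dx;  
  by apply: cvg_EFin; [exact: nearW|exact: ffx].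
- exact: ig.
- by apply: aeW => x n Dx; rewrite /= lee_fin fg.
move=> if_ _ h; apply: fine_cvg.
rewrite fineK//; exact: integrable_fin_num.
Qed.

Lemma ge0_subset_Rintegral f D D' : measurable D -> measurable D' ->
  mu.-integrable D' (EFin \o f) -> D `<=` D' -> (forall x, D' x -> 0 <= f x) ->
  \int[mu]_(x in D) f x <= \int[mu]_(x in D') f x.
Proof.
move=> mD mD' if' DD' f0; apply: fine_le.
- by apply: integrable_fin_num => //; exact: integrableS if'.
- exact: integrable_fin_num.
by apply: ge0_subset_integral => //; exact: measurable_int if'.
Qed.

Lemma Rintegral_support f D D' : (forall x, f x != 0 -> D x <-> D' x) ->
  \int[mu]_(x in D) f x = \int[mu]_(x in D') f x.
Proof.
move=> fDD'; rewrite Rintegral_mkcond [RHS]Rintegral_mkcond.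
apply: eq_Rintegral => x _; rewrite !patchE.
have [->|/fDD' [h1 h2]] := eqVneq (f x) 0; first by rewrite !if_same.
by congr (if _ then _ else _); apply/idP/idP; rewrite !inE.
Qed.

Lemma continuous_integrable f a b : {within `[a, b], continuous f} ->
  mu.-integrable `[a, b] (EFin \o f).
Proof. by apply: continuous_compact_integrable; exact: segment_compact. Qed.

Lemma Rintegral_cst1_itv b : 0 <= b -> \int[mu]_(x in `[0, b]) (1 : R) = b.
Proof.
move=> b0; rewrite Rintegral_cst// mul1r.
transitivity (fine (mu `[0, b])) => //; rewrite lebesgue_measure_itv/= lte_fin.
by move: b0; rewrite le_eqVlt => /predU1P[<-|->]; rewrite ?ltxx ?subr0 ?oppr0 ?addr0.
Qed.

(** On a set of finite measure |g| <= 1 + g^2. *)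
Lemma square_integrable_integrable (g : R -> R) : square_integrable g ->
  mu.-integrable `[0, 1] (EFin \o g).
Proof.
move=> [mg ig2].
have i0 : mu.-integrable `[0, 1] (EFin \o (cst 1 : R -> R)).
  by apply: (@bounded_integrable_itv _ _ _ 1) => // y _; rewrite normr1.
have i1 : mu.-integrable `[0, 1] (EFin \o (fun x => 1 + g x ^+ 2)).
  exact: EFin_integrableD.
apply: le_integrable i1 => //; first by apply/measurable_EFinP; exact: mg.
move=> x _ /=; rewrite lee_fin [leRHS]ger0_norm; last by rewrite addr_ge0// sqr_ge0.
by rewrite -real_normK ?num_real//; set z := `|g x|; have := sqr_ge0 (z - 1); nra.
Qed.

End Integration.

Section Primitive.
Variable R : realType.
Notation mu := (@lebesgue_measure R).

Lemma flat_algebra_integrable (f : R -> R) a b : flat_algebra R f ->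
  mu.-integrable `[a, b] (EFin \o f).
Proof.
move=> Cf; apply: continuous_integrable; apply: continuous_subspaceT.
exact: flat_algebra_continuous.
Qed.

Variables (psi : R -> R) (a b : R).
Hypotheses (Cpsi : flat_algebra R psi) (a0 : 0 < a) (b1 : b < 1).
Hypothesis psi_supp : forall x, psi x != 0 -> a <= x <= b.

Let phi x := \int[mu]_(t in `[0, x]) psi t.

(** For x > 0 this is the fundamental theorem of calculus; the support of [psi]
    starts at a > 0, so the primitive vanishes near every x <= 0. *)
Lemma is_derive_primitive (x : R) : is_derive x 1 phi (psi x).
Proof.
have [x0|x0] := ltP 0 x.
  have xx1 : x < x + 1 by rewrite ltrDl.
  have [] := @continuous_FTC1_closed R psi 0 x (x + 1) xx1 _ x0 _.
  - exact: flat_algebra_integrable.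
  - exact: flat_algebra_continuous.
  by move=> d e; apply: DeriveDef; [exact: d|rewrite -derive1E; exact: e].
have -> : psi x = 0.
  apply: contraTeq (x0) => /psi_supp/andP[ax _].
  by rewrite -ltNge (lt_le_trans a0).
apply: (near_eq_is_derive _ (@is_derive_cst _ _ _ 0 x 1)).
near=> y; rewrite /phi (@Rintegral_support _ _ _ set0) ?Rintegral_set0//.
move=> t /psi_supp/andP[at_ _]; split => //=; rewrite in_itv/= => /andP[_ ty].
have : y < a by near: y; apply: lt_nbhsl; exact: le_lt_trans a0.
by rewrite ltNge (le_trans at_).
Unshelve. all: by end_near. Qed.

(** The vanishing integral makes the primitive vanish to the right of b. *)
Lemma primitive_test_function : \int[mu]_(t in `[0, 1]) psi t = 0 ->
  test_function phi.
Proof.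
move=> psi0; have d1 : (phi^`())%classic = psi.
  apply/funext => x; rewrite derive1E.
  exact: (@derive_val _ _ _ _ _ _ _ (is_derive_primitive x)).
split.
  case=> [|k] x; last by rewrite derive1Sn d1; exact: flat_algebra_smooth.
  exact: (@ex_derive _ _ _ _ _ _ _ (is_derive_primitive x)).
exists a, b; split => // x; apply: contraR; rewrite negb_and -!ltNge => /orP[xa|bx].
  rewrite /phi (@Rintegral_support _ _ _ set0) ?Rintegral_set0//.
  move=> t /psi_supp/andP[at_ _]; split => //=; rewrite in_itv/= => /andP[_ tx].
  by move: xa; rewrite ltNge (le_trans at_).
rewrite /phi (@Rintegral_support _ _ _ `[0, 1]) ?psi0//.
move=> t /psi_supp/andP[at_ tb]; rewrite /= !in_itv/= (le_trans (ltW a0))//=.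
by rewrite (le_trans tb (ltW bx)) (le_trans tb (ltW b1)).
Qed.

Lemma weak_derivative_primitive h g : weak_derivative h g ->
  \int[mu]_(t in `[0, 1]) psi t = 0 ->
  \int[mu]_(x in `[0, 1]) (h x * psi x) =
  - \int[mu]_(x in `[0, 1]) (g x * phi x).
Proof.
move=> hg psi0; rewrite -(hg _ (primitive_test_function psi0)).
apply: eq_Rintegral => x _; congr (_ * _); rewrite derive1E.
by rewrite (@derive_val _ _ _ _ _ _ _ (is_derive_primitive x)).
Qed.
End Primitive.

(** * Peano representation of a point evaluation *)

Section FlatZero.
Variable R : realType.
Local Notation flat := (flat R).

Lemma flat_ge0 k (x : R) : 0 <= flat k x.
Proof.
rewrite /flat; case: ifP => // x0.
by rewrite mulr_ge0 ?expR_ge0 ?exprn_ge0// invr_ge0 ltW.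
Qed.

Lemma flat_le0 k (x : R) : x <= 0 -> flat k x = 0.
Proof. by rewrite /flat leNgt => /negbTE ->. Qed.

Lemma flat0_gt0 (x : R) : 0 < x -> flat 0 x = expR (- x^-1).
Proof. by move=> x0; rewrite /flat x0 mul1r. Qed.

Lemma flat0_le1 (x : R) : flat 0 x <= 1.
Proof.
have [x0|x0] := leP x 0; first by rewrite flat_le0.
by rewrite flat0_gt0// expR_le1 oppr_le0 invr_ge0 ltW.
Qed.

End FlatZero.

Section Peano.
Variables (R : realType) (p : R).
Hypothesis p01 : 0 < p < 1.
Local Notation flat := (flat R).
Notation mu := (@lebesgue_measure R).

(* The scale [e N] is at most half the distance of p to the endpoints, so the
   mollifier [rho N] is supported in [p - e, p + e], inside the support
   [e, 1 - e] of the smoothed indicator [chi N]. *)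
Let d := Num.min p (1 - p).
Let e (N : nat) := d / (N.+2)%:R.

Let d0 : 0 < d. Proof. by rewrite lt_min subr_gt0. Qed.
Let e0 N : 0 < e N. Proof. by rewrite divr_gt0. Qed.
Let ed N : e N *+ 2 <= d.
Proof.
rewrite /e -mulr_natl mulrCA ger_pMr// ler_pdivrMr// mul1r ler_nat.
by [].
Qed.
Let ep N : e N *+ 2 <= p.
Proof. by rewrite (le_trans (ed N))// ge_min lexx. Qed.
Let ep1 N : e N *+ 2 <= 1 - p.
Proof. by rewrite (le_trans (ed N))// ge_min lexx orbT. Qed.
Let e_cvg0 : e N @[N --> \oo] --> 0.
Proof.
rewrite -[X in _ --> X](mulr0 d); apply: cvgM; first exact: cvg_cst.
apply/gtr0_cvgV0; first by apply: nearW => n; rewrite ltr0n.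
have := @cvgr_idn R; rewrite -(cvg_shiftn 2) => h.
by apply: cvg_trans h; apply: near_eq_cvg; apply: nearW => n /=; rewrite addn2.
Qed.

Let chi N (x : R) := flat 0 ((e N)^-1 * x + (-1)) * flat 0 (- (e N)^-1 * x + ((e N)^-1 - 1)).
Let rho N (x : R) := flat 0 (1 * x + (e N - p)) * flat 0 (-1 * x + (p + e N)).

Let Cchi N : flat_algebra R (chi N). Proof. by do 2 constructor. Qed.
Let Crho N : flat_algebra R (rho N). Proof. by do 2 constructor. Qed.

Let chi_ge0 N x : 0 <= chi N x. Proof. by rewrite mulr_ge0 ?flat_ge0. Qed.
Let rho_ge0 N x : 0 <= rho N x. Proof. by rewrite mulr_ge0 ?flat_ge0. Qed.
Let chi_le1 N x : chi N x <= 1.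
Proof. by rewrite mulr_ile1 ?flat_ge0 ?flat0_le1. Qed.

Let chi_supp N x : chi N x != 0 -> e N <= x <= 1 - e N.
Proof.
apply: contraR; rewrite negb_and -!ltNge /chi => /orP[h|h].
  rewrite (flat_le0 _ _ (_ * x - 1)) ?mul0r//.
  by rewrite subr_le0 ler_pdivrMl// mulr1 ltW.
rewrite [X in _ * X]flat_le0 ?mulr0//.
have -> : - (e N)^-1 * x + ((e N)^-1 - 1) = (e N)^-1 * (1 - x) - 1 by ring.
by rewrite subr_le0 ler_pdivrMl// mulr1; lra.
Qed.
Let rho_supp N x : rho N x != 0 -> p - e N <= x <= p + e N.
Proof.
apply: contraR; rewrite negb_and -!ltNge /rho => /orP[h|h].
  by rewrite (flat_le0 _ _ (1 * x + _)) ?mul0r//; lra.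
by rewrite [X in _ * X]flat_le0 ?mulr0//; lra.
Qed.

Let Z N := \int[mu]_(x in `[0, 1]) rho N x.
Let c N := \int[mu]_(x in `[0, 1]) chi N x.

(* On the inner half of its support the mollifier is bounded below by m^2. *)
Let Z_gt0 N : 0 < Z N.
Proof.
have := ep N; have := ep1 N; have := e0 N; rewrite !mulr2n => eN ep1N epN.
set m := expR (- (e N / 2)^-1).
have flat_m y : e N / 2 <= y -> m <= flat 0 y.
  move=> ey; rewrite flat0_gt0; last by lra.
  by rewrite ler_expR lerN2 lef_pV2// posrE; lra.
pose J := `[p - e N / 2, p + e N / 2]%classic : set R.
have JI : J `<=` `[0, 1] by move=> y; rewrite /J /= !in_itv/= => /andP[? ?]; apply/andP; split; lra.
have irho : mu.-integrable `[0, 1] (EFin \o rho N) by exact: flat_algebra_integrable.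
apply: (@lt_le_trans _ _ (\int[mu]_(x in J) rho N x)); last first.
  by apply: ge0_subset_Rintegral => //; exact: measurable_itv.
apply: (@lt_le_trans _ _ (\int[mu]_(x in J) (m ^+ 2))).
  rewrite Rintegral_cst; last exact: measurable_itv.
  rewrite pmulr_rgt0 ?exprn_gt0 ?expR_gt0//.
  have : fine (mu J) = e N.
    rewrite lebesgue_measure_itv/= lte_fin ifT/=; last by lra.
    by field.
  by move=> muJ; rewrite (lt_le_trans eN)// -[leLHS]muJ lexx.
apply: le_Rintegral; first exact: measurable_itv.
- by apply: bounded_integrable_itv => // y _; exact: lexx.
- by apply: integrableS irho => //; exact: measurable_itv.
move=> y; rewrite /J /= in_itv/= => /andP[y1 y2].
by rewrite expr2 ler_pM ?expR_ge0//; apply: flat_m; lra.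
Qed.

Let chi_cvg (x : R) : 0 < x < 1 -> chi N x @[N --> \oo] --> (1:R).
Proof.
move=> /andP[x0 x1].
have h (y : R) : 0 < y -> flat 0 ((e N)^-1 * y + (-1)) @[N --> \oo] --> (1:R).
  move=> y0.
  have key : expR (- (e N / (y - e N))) @[N --> \oo] --> (1:R).
    rewrite -expR0; apply: continuous_cvg; first exact: continuous_expR.
    rewrite -oppr0; apply: cvgN.
    rewrite -[X in _ --> X](mul0r (y - 0)^-1); apply: cvgM => //.
    apply: cvgV; first by rewrite subr0 gt_eqF.
    by apply: cvgB => //; exact: cvg_cst.
  apply: cvg_trans key; apply: near_eq_cvg; near=> N.
  have eNy : e N < y by near: N; exact: (cvgr_lt 0).
  have ye0 : 0 < y - e N by rewrite subr_gt0.
  have E : (e N)^-1 * y + -1 = (y - e N) / e N.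
    by field; rewrite gt_eqF.
  by rewrite E flat0_gt0 ?divr_gt0// invf_div.
rewrite -[X in _ --> X](mulr1 1); apply: cvgM; first exact: h.
rewrite (_ : (fun N => _) = (fun N => flat 0 ((e N)^-1 * (1 - x) + (-1)))).
  by apply: h; rewrite subr_gt0.
by apply/funext => N; congr flat; ring.
Unshelve. all: by end_near. Qed.

Let cint b f : flat_algebra R f -> mu.-integrable `[0, b] (EFin \o f).
Proof. exact: flat_algebra_integrable. Qed.

Let primitive_chi_cvg (x : R) : 0 <= x <= 1 -> \int[mu]_(t in `[0, x]) chi N t @[N --> \oo] --> x.
Proof.
move=> /andP[x0 x1]; rewrite -[X in _ --> X](Rintegral_cst1_itv _ _ x0).
apply: (dominated_cvg_Rintegral _ _ _ _ (cst 1)) => //.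
- move=> n; apply/measurable_EFinP; exact: measurable_int (cint _ _ (Cchi n)).
- by apply: bounded_integrable_itv => // y _; rewrite normr1.
- by move=> n y _; rewrite ger0_norm.
exists [set 0; 1]; split.
- by apply: measurableU; exact: measurable_set1.
- rewrite measureU0//; last exact: lebesgue_measure_set1.
  exact: lebesgue_measure_set1.
move=> y /= /not_implyP[]; rewrite in_itv/= => /andP[y0 yx] nc.
apply: contrapT => /not_orP[/eqP yn0 /eqP yn1]; apply: nc; apply: chi_cvg.
by rewrite !lt_neqAle y0 (le_trans yx x1) yn1 eq_sym yn0.
Qed.

Let A N x := \int[mu]_(t in `[0, x]) rho N t.

Let primitive_rho_small N (x : R) : x < p - e N -> A N x = 0.
Proof.
move=> xp; rewrite /A (@Rintegral_support _ _ _ set0) ?Rintegral_set0// => t.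
move=> /rho_supp/andP[pt _]; split => //=; rewrite in_itv/= => /andP[_ tx].
by move: xp; rewrite ltNge (le_trans pt).
Qed.

Let primitive_rho_large N (x : R) : p + e N < x -> A N x = Z N.
Proof.
move=> xp; apply: Rintegral_support => t /rho_supp/andP[pt tp] /=.
rewrite !in_itv/=.
have := ep N; have := ep1 N; have := e0 N; rewrite !mulr2n => *.
by split => _; apply/andP; split; lra.
Qed.

Let primitive_rho_bound N (x : R) : x <= 1 -> 0 <= A N x <= Z N.
Proof.
move=> x1; rewrite Rintegral_ge0//=.
apply: ge0_subset_Rintegral => //; first exact: cint.
by move=> t /=; rewrite !in_itv/= => /andP[-> /le_trans ->].
Qed.

(* The coefficient of the mollifier makes the integral of [psi] over [0, 1] zero. *)
Let psi N x := chi N x + (- (c N / Z N)) * rho N x.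

Let phi N x := \int[mu]_(t in `[0, x]) psi N t.

Let phiE N x : phi N x = \int[mu]_(t in `[0, x]) chi N t - c N * (A N x / Z N).
Proof.
rewrite /phi RintegralD//; [|exact: cint|by apply: cint; constructor].
rewrite RintegralZl//; last exact: cint.
by rewrite -/(A N x) mulNr; congr (_ - _); ring.
Qed.

Let c01 N : 0 <= c N <= 1.
Proof.
rewrite Rintegral_ge0//= -[leRHS](@Rintegral_cst1_itv R 1)//.
apply: le_Rintegral => //; first exact: cint.
by apply: bounded_integrable_itv => // y _; rewrite normr1.
Qed.

Let phi_bound N (x : R) : 0 <= x <= 1 -> `|phi N x| <= 1.
Proof.
move=> /andP[x0 x1]; rewrite phiE.
have B0 : 0 <= \int[mu]_(t in `[0, x]) chi N t by exact: Rintegral_ge0.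
have B1 : \int[mu]_(t in `[0, x]) chi N t <= c N.
  apply: ge0_subset_Rintegral => //; first exact: cint.
  by move=> t /=; rewrite !in_itv/= => /andP[-> /le_trans ->].
have /andP[A0 A1] := primitive_rho_bound N _ x1.
have /andP[c0 c1] := c01 N.
have AZ0 : 0 <= A N x / Z N := divr_ge0 A0 (ltW (Z_gt0 N)).
have AZ1 : A N x / Z N <= 1 by rewrite (ler_pdivrMr _ _ (Z_gt0 N)) mul1r.
have cA : c N * (A N x / Z N) <= 1 := mulr_ile1 c0 AZ0 c1 AZ1.
have cA0 : 0 <= c N * (A N x / Z N) := mulr_ge0 c0 AZ0.
rewrite ler_norml; apply/andP; split.
  by rewrite -[leLHS]sub0r; exact: lerB B0 cA.
by rewrite -[leRHS]subr0; exact: lerB (le_trans B1 c1) cA0.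
Qed.

(* The primitive of [chi] tends to x and that of the normalized mollifier to the
   step function at p. *)
Let phi_cvg (x : R) : 0 <= x <= 1 -> x != p ->
  phi N x @[N --> \oo] --> (x - (p < x)%R%:R : R).
Proof.
move=> x01 xp; under eq_fun do rewrite phiE.
apply: cvgB; first exact: primitive_chi_cvg.
rewrite -[X in _ --> X]mul1r; apply: cvgM; first by apply: primitive_chi_cvg; rewrite ler01/=.
have [px|px] := ltP p x.
  have xp0 : 0 < x - p by rewrite subr_gt0.
  apply: cvg_near_cst.
  near=> N; rewrite primitive_rho_large ?divff ?gt_eqF//.
  by rewrite -ltrBrDl; near: N; exact: (cvgr_lt 0).
have {}px : x < p by rewrite lt_neqAle xp.
have xp0 : 0 < p - x by rewrite subr_gt0.
apply: cvg_near_cst.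
near=> N; rewrite primitive_rho_small ?mul0r//.
by rewrite ltrBrDl -ltrBrDr; near: N; exact: (cvgr_lt 0).
Unshelve. all: by end_near. Qed.


Variables h g : R -> R.
Hypothesis hg : H1 h g.

Let ih : mu.-integrable `[0, 1] (EFin \o h).
Proof. by case: hg => ch _ _ _; exact: continuous_integrable. Qed.

Let ig : mu.-integrable `[0, 1] (EFin \o g).
Proof. by case: hg => _ _ g2 _; exact: square_integrable_integrable. Qed.

Let moll_cvg : \int[mu]_(x in `[0, 1]) (h x * rho N x) / Z N @[N --> \oo] --> h p.
Proof.
have [ch _ _ _] := hg.
have hp : {for p, continuous h}.
  by apply: (within_continuous_continuous _ ch); rewrite ?ltr01// in_itv.
apply/cvgrPdist_le => eta eta0.
have /cvgrPdist_le/(_ _ eta0)/nbhs_ballP[r /= r0 hr] := hp.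
near=> N.
have er : e N < r by near: N; exact: (cvgr_lt 0).
have iab : mu.-integrable `[0, 1] (EFin \o (fun x => h x * rho N x)).
  apply: continuous_integrable => x; apply: cvgM; first exact: ch.
  by apply: continuous_subspaceT; exact: flat_algebra_continuous.
have irho := cint 1 _ (Crho N).
have ihp : mu.-integrable `[0, 1] (EFin \o (fun x => h p * rho N x)).
  by apply: cint; constructor.
have -> : h p - \int[mu]_(x in `[0, 1]) (h x * rho N x) / Z N =
    (\int[mu]_(x in `[0, 1]) (h p * rho N x - h x * rho N x)) / Z N.
  rewrite RintegralB// RintegralZl// -/(Z N); field.
  by rewrite gt_eqF.
rewrite normrM normfV (gtr0_norm (Z_gt0 N)) ler_pdivrMr//.
have iB : mu.-integrable `[0, 1] (EFin \o (fun x => h p * rho N x - h x * rho N x)).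
  exact: EFin_integrableB.
apply: (@le_trans _ _ (\int[mu]_(x in `[0, 1]) `|h p * rho N x - h x * rho N x|)).
  exact: le_normr_Rintegral.
rewrite -RintegralZl//; apply: le_Rintegral => //.
- exact: integrable_norm.
- by apply: cint; constructor.
move=> x _; rewrite -mulrBl normrM (ger0_norm (rho_ge0 _ _)).
have [->|/rho_supp/andP[px xp]] := eqVneq (rho N x) 0; first by rewrite !mulr0.
rewrite ler_wpM2r//; apply: hr; rewrite /ball/= ltr_distlC.
by apply/andP; split; [rewrite (lt_le_trans _ px)// ltrD2l ltrN2|rewrite (le_lt_trans xp)// ltrD2l].
Unshelve. all: by end_near. Qed.

(** Passing to the limit in the definition of the weak derivative for the test
    functions [phi N]: the left side is a combination of the integral of
    h against [chi N] and a mollified value of h at p, the right side converges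
    by domination by |g|. *)
Lemma peano_point_evaluation :
  \int[mu]_(x in `[0, 1]) h x - h p =
  - \int[mu]_(x in `[0, 1]) (g x * (x - (p < x)%R%:R)).
Proof.
have [ch [mh _] [mg _] wd] := hg.
have Cpsi N : flat_algebra R (psi N) by apply: flatD; [exact: Cchi|apply: flatZ; exact: Crho].
have psi_supp N x : psi N x != 0 -> e N <= x <= 1 - e N.
  have [c0|/chi_supp//] := eqVneq (chi N x) 0.
  rewrite /psi c0 add0r mulf_eq0 negb_or => /andP[_ /rho_supp/andP[px xp]].
  have := ep N; have := ep1 N; rewrite !mulr2n => ep1N epN.
  by apply/andP; split; lra.
have psi0 N : \int[mu]_(t in `[0, 1]) psi N t = 0.
  rewrite -[LHS]/(phi N 1) phiE -/(c N) -[A N 1]/(Z N) divff ?gt_eqF// mulr1.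
  by rewrite subrr.
have key N : \int[mu]_(x in `[0, 1]) (h x * chi N x) -
    c N * (\int[mu]_(x in `[0, 1]) (h x * rho N x) / Z N) =
    - \int[mu]_(x in `[0, 1]) (g x * phi N x).
  have eN1 : 1 - e N < 1 by rewrite gtrBl.
  rewrite -(weak_derivative_primitive _ _ _ _ (Cpsi N) (e0 N) eN1 (psi_supp N) _ _ wd (psi0 N)).
  have ic f : flat_algebra R f -> mu.-integrable `[0, 1] (EFin \o (fun x => h x * f x)).
    move=> Cf; apply: continuous_integrable => x; apply: cvgM; first exact: ch.
    by apply: continuous_subspaceT; exact: flat_algebra_continuous.
  transitivity (\int[mu]_(x in `[0, 1])
      (h x * chi N x + (- (c N / Z N)) * (h x * rho N x))); last first.
    by apply: eq_Rintegral => x _; rewrite /psi mulrDr; congr (_ + _); rewrite mulrCA.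
  rewrite RintegralD//; [|exact: ic (Cchi N)|].
    rewrite RintegralZl//; last exact: ic (Crho N).
    by rewrite mulNr; congr (_ - _); ring.
  by apply: EFin_integrableZ => //; exact: ic (Crho N).
have L : \int[mu]_(x in `[0, 1]) (h x * chi N x) -
    c N * (\int[mu]_(x in `[0, 1]) (h x * rho N x) / Z N) @[N --> \oo] -->
    \int[mu]_(x in `[0, 1]) h x - h p.
  apply: cvgB; last first.
    rewrite -[h p]mul1r; apply: cvgM => //.
    by apply: primitive_chi_cvg; rewrite ler01/=.
  apply: (dominated_cvg_Rintegral _ _ _ _ (fun x => `|h x|)) => //.
  - move=> n; apply: measurable_funM => //.
    by apply/measurable_EFinP; exact: measurable_int (cint 1 _ (Cchi n)).
  - exact: integrable_norm.
  - move=> n x _; rewrite normrM ler_piMr// ger0_norm//.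
  exists [set 0; 1]; split.
  - by apply: measurableU; exact: measurable_set1.
  - rewrite measureU0//; last exact: lebesgue_measure_set1.
    exact: lebesgue_measure_set1.
  move=> y /= /not_implyP[]; rewrite in_itv/= => /andP[y0 y1] nc.
  apply: contrapT => /not_orP[/eqP yn0 /eqP yn1]; apply: nc.
  rewrite -[X in _ --> X]mulr1; apply: cvgM; first exact: cvg_cst.
  by apply: chi_cvg; rewrite !lt_neqAle y0 y1 yn1 eq_sym yn0.
have L' : (- \int[mu]_(x in `[0, 1]) (g x * phi N x)) @[N --> \oo] -->
    - \int[mu]_(x in `[0, 1]) (g x * (x - (p < x)%R%:R)).
  apply: cvgN; apply: (dominated_cvg_Rintegral _ _ _ _ (fun x => `|g x|)) => //.
  - move=> n; apply: measurable_funM => //.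
    apply: subspace_continuous_measurable_fun => //.
    apply: continuous_subspaceT => x; apply: differentiable_continuous.
    apply/derivable1_diffP.
    exact: (@ex_derive _ _ _ _ _ _ _ (is_derive_primitive _ _ _ _ (Cpsi n) (e0 n) (psi_supp n) x)).
  - apply: measurable_funM => //; apply: measurable_funB => //.
    by apply: measurableT_comp => //; exact: measurable_fun_ltr.
  - exact: integrable_norm.
  - move=> n x /=; rewrite in_itv/= => x01; rewrite normrM ler_piMr// phi_bound//.
  exists [set p]; split; [exact: measurable_set1|exact: lebesgue_measure_set1|].
  move=> y /= /not_implyP[]; rewrite in_itv/= => y01 nc.
  apply: contrapT => /eqP yp; apply: nc.
  by apply: cvgM; [exact: cvg_cst|exact: phi_cvg].
move: L; under eq_fun do rewrite key.
by move=> L; exact: (cvg_unique _ L L').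
Qed.
End Peano.

(** * The squared norm of the Peano kernel *)

Section Kernel.
Variable R : realType.
Notation mu := (@lebesgue_measure R).

Lemma Rintegral_antiderivative (f F : R -> R) (a b : R) : a <= b ->
  continuous f -> (forall x : R, is_derive x 1 F (f x)) ->
  \int[mu]_(x in `[a, b]) f x = F b - F a.
Proof.
move=> + cf dF; rewrite le_eqVlt => /predU1P[->|ab].
  by rewrite set_itv1 Rintegral_set1 subrr.
have cF := is_derive_continuous _ _ _ dF.
rewrite /Rintegral (continuous_FTC2 ab _ (F := F)) -?EFinB//.
- exact: continuous_subspaceT.
- split.
  + by move=> x _; exact: (@ex_derive _ _ _ _ _ _ _ (dF x)).
  + exact: cvg_at_right_filter (cF a).
  + exact: cvg_at_left_filter (cF b).
- move=> x _; rewrite derive1E; exact: (@derive_val _ _ _ _ _ _ _ (dF x)).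
Qed.

Lemma is_derive_monomial n (x : R) :
  is_derive x 1 (fun y : R => y ^+ n.+1 / n.+1%:R) (x ^+ n).
Proof.
have -> : (fun y : R => y ^+ n.+1 / n.+1%:R) = n.+1%:R^-1 *: (id ^+ n.+1 : R -> R).
  by apply/funext => y; rewrite scalrfctE exprfctE /GRing.scale/= mulrC.
apply: is_derive_eq.
by rewrite /GRing.scale/= mulr1 mulKf// pnatr_eq0.
Qed.

Lemma Rintegral_step (f F : R -> R) (p : R) : 0 <= p <= 1 ->
  continuous f -> (forall x : R, is_derive x 1 F (f x)) ->
  \int[mu]_(x in `[0, 1]) (f x * (p < x)%R%:R) = F 1 - F p.
Proof.
move=> /andP[p0 p1] cf dF.
rewrite -(Rintegral_antiderivative f F p 1)// -Rintegral_itv_obnd_cbnd; last first.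
  apply: (@integrableS _ _ _ mu `[p, 1]) => //.
    by move=> x /=; rewrite !in_itv/= => /andP[/ltW -> ->].
  by apply: continuous_integrable; exact: continuous_subspaceT.
rewrite Rintegral_mkcond [RHS]Rintegral_mkcond; apply: eq_Rintegral => x _.
rewrite !patchE !mem_setE !in_itv/=.
case: (ltP p x) => px /=; last by rewrite mulr0 if_same.
by rewrite mulr1 (le_trans p0 (ltW px)).
Qed.

Lemma measurable_step (D : set R) (p : R) : measurable D ->
  measurable_fun D (fun x => (p < x)%R%:R : R).
Proof.
by move=> mD; apply: measurableT_comp => //; exact: measurable_fun_ltr.
Qed.

(** The Peano kernel of the functional h |-> int h - h p, up to sign. *)
Definition peano_step (p x : R) : R := x - (p < x)%R%:R.

Lemma measurable_peano_step (D : set R) p : measurable D ->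
  measurable_fun D (peano_step p).
Proof. by move=> mD; apply: measurable_funB => //; exact: measurable_step. Qed.

Lemma peano_step_bound p x : 0 <= x <= 1 -> `|peano_step p x| <= 1.
Proof.
by move=> x01; rewrite /peano_step; case: (p < x) => /=; rewrite ler_norml; lra.
Qed.

Lemma Rintegral_peano_step2 p q : 0 <= p <= 1 -> 0 <= q <= 1 ->
  \int[mu]_(x in `[0, 1]) (peano_step p x * peano_step q x) =
  3^-1 + (p ^+ 2 + q ^+ 2) / 2 - Num.max p q.
Proof.
wlog pq : p q / p <= q => [H p01 q01|p01 q01].
  have [pq|qp] := orP (le_total p q); first exact: H.
  rewrite maxC [p ^+ 2 + _]addrC -(H _ _ qp)//.
  by apply: eq_Rintegral => x _; rewrite mulrC.
rewrite (max_idPr pq).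
pose sq x := x ^+ 2 : R.
transitivity (\int[mu]_(x in `[0, 1]) (sq x - id x * (p < x)%R%:R - id x * (q < x)%R%:R + 1 * (q < x)%R%:R)).
  apply: eq_Rintegral => x _; rewrite /peano_step /sq.
  case: (ltP q x) => /= qx; last by ring.
  by rewrite (le_lt_trans pq qx) /=; ring.
have csq : continuous sq by move=> x; exact: exprn_continuous.
have dsq := is_derive_monomial 2.
have did := is_derive_monomial 1.
have did1 (x : R) : is_derive x 1 (id : R -> R) (cst 1 x) by exact: is_derive_id.
have isq : mu.-integrable `[0, 1] (EFin \o sq).
  by apply: continuous_integrable; exact: continuous_subspaceT.
have ist r (f : R -> R) : continuous f -> mu.-integrable `[0, 1] (EFin \o (fun x => f x * (r < x)%R%:R)).
  move=> cf; have := @bounded_integrableM _ _ (fun x => (r < x)%R%:R) f 1 (measurable_itv `[0,1]%R) (measurable_step _ _ (measurable_itv _)).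
  rewrite (_ : (fun x => _ * f x) = (fun x => f x * (r < x)%R%:R)).
    apply; first by move=> x _; case: (r < x); rewrite /= ?normr1 ?normr0.
    by apply: continuous_integrable; exact: continuous_subspaceT.
  by apply/funext => x; rewrite mulrC.
have cid : continuous (id : R -> R) by move=> x.
have cone : continuous (cst 1 : R -> R) by move=> x; exact: cvg_cst.
rewrite RintegralD//; last 2 first.
- by apply: EFin_integrableB => //; [apply: EFin_integrableB => //|]; exact: ist.
- exact: (ist _ (cst 1)).
rewrite RintegralB//; last 2 first.
- by apply: EFin_integrableB => //; exact: ist.
- exact: ist.
rewrite RintegralB//; last exact: ist.
rewrite (Rintegral_antiderivative _ _ _ _ _ csq dsq)//.
rewrite !(Rintegral_step _ _ _ _ cid did)// (Rintegral_step (cst 1) _ _ _ cone did1)//.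
rewrite !expr1n !expr0n/=; by field.
Qed.

Lemma Rintegral_sum (n : nat) (f : 'I_n -> R -> R) (D : set R) : measurable D ->
  (forall i, mu.-integrable D (EFin \o f i)) ->
  mu.-integrable D (EFin \o (fun x => \sum_(i < n) f i x)) /\
  \int[mu]_(x in D) (\sum_(i < n) f i x) = \sum_(i < n) \int[mu]_(x in D) f i x.
Proof.
move=> mD; elim: n f => [|n IH] f intf.
  rewrite (_ : (fun x => _) = cst 0); last by apply/funext => x; rewrite big_ord0.
  rewrite big_ord0; split; first exact: integrable0.
  by have := @Rintegral_cst _ _ _ mu D mD 0; rewrite mul0r.
have [h1 h2] := IH (fun i => f (widen_ord (leqnSn n) i)) (fun i => intf _).
rewrite big_ord_recr/= -h2 -RintegralD//.
have E : (fun x => \sum_(i < n.+1) f i x) = (fun x =>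
    \sum_(i < n) f (widen_ord (leqnSn n) i) x + f ord_max x).
  by apply/funext => x; rewrite big_ord_recr.
by rewrite E; split => //; exact: EFin_integrableD.
Qed.

(** With S the inner product of K and g, the integral of (S g - K)^2 is
    nonnegative; expanding it and using int g^2 <= 1 gives S^2 <= int K^2. *)
Lemma cauchy_schwarz_unit (g K : R -> R) (M : R) : square_integrable g ->
  measurable_fun (`[0, 1] : set R) K -> (forall x, 0 <= x <= 1 -> `|K x| <= M) ->
  \int[mu]_(x in `[0, 1]) (g x ^+ 2) <= 1 ->
  (\int[mu]_(x in `[0, 1]) (K x * g x)) ^+ 2 <= \int[mu]_(x in `[0, 1]) (K x ^+ 2).
Proof.
move=> g2 mK KM g1; have ig := square_integrable_integrable _ _ g2.
case: g2 => mg ig2.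
set S := \int[mu]_(x in _) _.
have iKg : mu.-integrable `[0, 1] (EFin \o (fun x => K x * g x)).
  by apply: (@bounded_integrableM _ _ _ _ M).
have iKK : mu.-integrable `[0, 1] (EFin \o (fun x => K x ^+ 2)).
  apply: (@bounded_integrable_itv _ _ _ _ (M ^+ 2)); first exact: measurable_funX.
  by move=> x /KM h; rewrite normrX lerXn2r ?nnegrE// (le_trans _ h).
have : 0 <= \int[mu]_(x in `[0, 1]) (S ^+ 2 * (g x ^+ 2) - (2 * S) * (K x * g x) + K x ^+ 2).
  apply: Rintegral_ge0 => x _.
  rewrite (_ : _ + _ = (S * g x - K x) ^+ 2) ?sqr_ge0//; ring.
rewrite RintegralD//; last by apply: EFin_integrableB => //; exact: EFin_integrableZ.
rewrite RintegralB//; [|exact: EFin_integrableZ..].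
rewrite !RintegralZl// -/S => h.
have : S ^+ 2 * \int[mu]_(x in `[0, 1]) (g x ^+ 2) <= S ^+ 2 by rewrite ler_piMr// sqr_ge0.
by move: h; rewrite !expr2; nra.
Qed.

(** As the weights sum to 1, averaging the Peano formula over the nodes gives a
    single kernel; the right-hand side is its squared L^2 norm. *)
Lemma quadrature_error_bound (n : nat) (X w : 'I_n -> R) (h g : R -> R) :
  (forall i, 0 < X i < 1) -> \sum_i w i = 1 -> H1 h g -> H1_norm h g <= 1 ->
  (\int[mu]_(x in `[0, 1]) h x - \sum_(i < n) w i * h (X i)) ^+ 2 <=
  \sum_(i < n) \sum_(j < n) w i * w j *
    (3^-1 + (X i ^+ 2 + X j ^+ 2) / 2 - Num.max (X i) (X j)).
Proof.
move=> X01 w1 hg hg1.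
have X01' i : 0 <= X i <= 1 by have /andP[/ltW-> /ltW->] := X01 i.
have [_ [_ _] g2 _] := hg.
have ig := square_integrable_integrable _ _ g2.
pose K x := \sum_(i < n) w i * peano_step (X i) x.
have mI : measurable (`[0, 1] : set R) by exact: measurable_itv.
have istep p : mu.-integrable `[0, 1] (EFin \o (fun x => peano_step p x * g x)).
  apply: (@bounded_integrableM _ _ _ _ 1) => //; first exact: measurable_peano_step.
  by move=> x /=; rewrite in_itv; exact: peano_step_bound.
have errE : \int[mu]_(x in `[0, 1]) h x - \sum_(i < n) w i * h (X i) =
    - \int[mu]_(x in `[0, 1]) (K x * g x).
  have -> : \int[mu]_(x in `[0, 1]) (K x * g x) =
      \sum_(i < n) \int[mu]_(x in `[0, 1]) (w i * (peano_step (X i) x * g x)).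
    have [|_ <-] := @Rintegral_sum n (fun i x => w i * (peano_step (X i) x * g x)) _ mI.
      by move=> i; exact: EFin_integrableZ.
    by apply: eq_Rintegral => x _; rewrite /K mulr_suml; apply: eq_bigr => i _; rewrite mulrA.
  have -> : \int[mu]_(x in `[0, 1]) h x = \sum_(i < n) w i * \int[mu]_(x in `[0, 1]) h x.
    by rewrite -mulr_suml w1 mul1r.
  rewrite -sumrB -sumrN.
  apply: eq_bigr => i _; rewrite -mulrBr (peano_point_evaluation _ _ (X01 i) _ _ hg).
  rewrite RintegralZl// mulrN; congr (- (_ * _)).
  by apply: eq_Rintegral => x _; rewrite mulrC.
have mK : measurable_fun (`[0, 1] : set R) K.
  apply: measurable_sum => i; apply: measurable_funM => //.
  exact: measurable_peano_step.
have KM x : 0 <= x <= 1 -> `|K x| <= \sum_(i < n) `|w i|.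
  move=> x01; apply: (le_trans (ler_norm_sum _ _ _)); apply: ler_sum => i _.
  by rewrite normrM ler_piMr// peano_step_bound.
have g1 : \int[mu]_(x in `[0, 1]) (g x ^+ 2) <= 1.
  have h0 : 0 <= \int[mu]_(x in `[0, 1]) (h x ^+ 2) by apply: Rintegral_ge0 => x _; exact: sqr_ge0.
  have g0 : 0 <= \int[mu]_(x in `[0, 1]) (g x ^+ 2) by apply: Rintegral_ge0 => x _; exact: sqr_ge0.
  have : \int[mu]_(x in `[0, 1]) (h x ^+ 2) + \int[mu]_(x in `[0, 1]) (g x ^+ 2) <= 1.
    by rewrite -ler_sqrt// sqrtr1.
  by apply: le_trans; rewrite lerDr.
rewrite errE sqrrN (le_trans (cauchy_schwarz_unit _ _ _ g2 mK KM g1))//.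
have istep2 p q : mu.-integrable `[0, 1] (EFin \o (fun x => peano_step p x * peano_step q x)).
  apply: (@bounded_integrable_itv _ _ _ _ 1).
    by apply: measurable_funM; exact: measurable_peano_step.
  by move=> x x01; rewrite normrM mulr_ile1// peano_step_bound.
pose F i x := \sum_(j < n) (w i * w j) * (peano_step (X i) x * peano_step (X j) x).
have iF i : mu.-integrable `[0, 1] (EFin \o F i) /\ \int[mu]_(x in `[0, 1]) F i x =
   \sum_(j < n) w i * w j * (3^-1 + (X i ^+ 2 + X j ^+ 2) / 2 - Num.max (X i) (X j)).
  have [|h1 h2] := @Rintegral_sum n (fun j x => (w i * w j) * (peano_step (X i) x * peano_step (X j) x)) _ mI.
    by move=> j; exact: EFin_integrableZ.
  split=> //; rewrite h2; apply: eq_bigr => j _.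
  by rewrite RintegralZl// Rintegral_peano_step2.
have [|_ h2] := @Rintegral_sum n F _ mI; first by move=> i; case: (iF i).
rewrite le_eqVlt; apply/orP; left; apply/eqP.
transitivity (\int[mu]_(x in `[0, 1]) (\sum_(i < n) F i x)).
  apply: eq_Rintegral => x _; rewrite expr2 {1}/K mulr_suml; apply: eq_bigr => i _.
  rewrite /K mulr_sumr; apply: eq_bigr => j _; ring.
by rewrite h2; apply: eq_bigr => i _; case: (iF i).
Qed.

End Kernel.

(** * The upper bound for the Poincaré quadrature *)

Section UpperBound.
Variable R : realType.
Notation mu := (@lebesgue_measure R).

(** The value i is the maximum of exactly 2 i + 1 pairs. *)
Lemma sum_maxn (f : nat -> R) n :
  \sum_(i < n) \sum_(j < n) f (maxn i j) = \sum_(i < n) (i.*2.+1)%:R * f i.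
Proof.
elim: n => [|n IH]; first by rewrite !big_ord0.
rewrite big_ord_recr/=; under eq_bigr => i _.
  rewrite big_ord_recr/= (maxn_idPr (ltnW (ltn_ord i))); over.
rewrite big_split/= IH big_ord_recr/= maxnn sumr_const card_ord.
rewrite [X in _ + (X + _)](_ : _ = \sum_(i < n) f n); last first.
  by apply: eq_bigr => i _; rewrite (maxn_idPl (ltnW (ltn_ord i))).
rewrite sumr_const card_ord [RHS]big_ord_recr/= -addrA; congr (_ + _).
by rewrite -[in RHS]natr1 -addnn natrD -[f n *+ n]mulr_natl; ring.
Qed.

Lemma sum_odd_squares n :
  \sum_(k < n) (k.*2.+1)%:R ^+ 2 = n%:R * (4 * n%:R ^+ 2 - 1) / 3 :> R.
Proof.
elim: n => [|n IH]; first by rewrite big_ord0 !mul0r.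
rewrite big_ord_recr/= IH -[(n.*2).+1]addn1 -muln2 -[n.+1]addn1 !natrD natrM.
by field.
Qed.

Definition midpoint (n k : nat) : R := (k.*2.+1)%:R / (n.*2)%:R.

(** The squared norm of the Peano kernel of the midpoint rule.  With s the sum of
    the squared midpoints, the double sum of the maxima is 2 n s, so everything
    reduces to the sum of the first n odd squares. *)
Lemma midpoint_kernel_sum n : (0 < n)%N ->
  \sum_(i < n) \sum_(j < n) n%:R^-1 * n%:R^-1 *
    (3^-1 + (midpoint n i ^+ 2 + midpoint n j ^+ 2) / 2 -
     Num.max (midpoint n i) (midpoint n j)) = (12 * n%:R ^+ 2)^-1 :> R.
Proof.
move=> n0; have nz : n%:R != 0 :> R by rewrite pnatr_eq0 -lt0n.
pose s := \sum_(k < n) midpoint n k ^+ 2.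
have sE : s = (4 * n%:R ^+ 2 - 1) / (12 * n%:R).
  transitivity ((\sum_(k < n) (k.*2.+1)%:R ^+ 2) / (n.*2)%:R ^+ 2 : R).
    by rewrite mulr_suml; apply: eq_bigr => k _; rewrite /midpoint expr_div_n.
  by rewrite sum_odd_squares -muln2 natrM; field.
have maxE (i j : nat) : Num.max (midpoint n i) (midpoint n j) = midpoint n (maxn i j).
  have le k l : (k <= l)%N -> midpoint n k <= midpoint n l.
    by move=> kl; rewrite /midpoint ler_pM2r ?invr_gt0 ?ltr0n ?double_gt0// ler_nat ltnS leq_double.
  by case: (leqP i j) => [ij|/ltnW ji]; [rewrite (max_idPr (le _ _ ij))|rewrite (max_idPl (le _ _ ji))].
have smax : \sum_(i < n) \sum_(j < n) midpoint n (maxn i j) = (n.*2)%:R * s.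
  rewrite sum_maxn mulr_sumr; apply: eq_bigr => k _.
  rewrite /midpoint; have d0 : (n.*2)%:R != 0 :> R by rewrite pnatr_eq0 double_eq0 -lt0n.
  by field.
have s1 : \sum_(i < n) \sum_(j < n) midpoint n i ^+ 2 = n%:R * s.
  rewrite mulr_sumr; apply: eq_bigr => k _.
  by rewrite sumr_const card_ord mulr_natl.
have s2 : \sum_(i < n) \sum_(j < n) midpoint n j ^+ 2 = n%:R * s.
  by rewrite sumr_const card_ord mulr_natl.
have sc (a : R) : \sum_(i < n) \sum_(j < n) a = n%:R * n%:R * a.
  by rewrite !sumr_const !card_ord -mulrA !mulr_natl.
transitivity (n%:R^-1 * n%:R^-1 * (n%:R * n%:R * 3^-1 + (n%:R * s + n%:R * s) / 2 - (n.*2)%:R * s)).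
  rewrite -smax -{1}s1 -s2 -sc -big_split/= mulr_suml -big_split/= -sumrB mulr_sumr.
  apply: eq_bigr => i _; rewrite -big_split/= mulr_suml -big_split/= -sumrB mulr_sumr.
  by apply: eq_bigr => j _; rewrite maxE.
by rewrite sE -muln2 natrM; field.
Qed.

Lemma Rintegral_poincare_basis m :
  \int[mu]_(x in `[0, 1]) poincare_basis m x = (m == 0%N)%:R :> R.
Proof.
rewrite /poincare_basis; case: eqVneq => [_|m0]; first exact: Rintegral_cst1_itv.
have mz : m%:R != 0 :> R by rewrite pnatr_eq0.
have piz : pi != 0 :> R by rewrite gt_eqF// pi_gt0.
have sin_m k : sin (k%:R * pi) = 0 :> R.
  elim: k => [|k IH]; first by rewrite mul0r sin0.
  by rewrite -natr1 mulrDl mul1r sinDpi IH oppr0.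
have dF (x : R) : is_derive x 1 (fun x : R => Num.sqrt 2 / (m%:R * pi) * sin (m%:R * pi * x))
    (Num.sqrt 2 * cos (m%:R * pi * x)).
  have d1 : is_derive x 1 (fun y : R => m%:R * pi * y) (m%:R * pi).
    by apply: is_derive_eq; rewrite /GRing.scale/= mulr1.
  have d2 := @is_derive1_comp _ sin (fun y : R => m%:R * pi * y) x _ _ (is_derive_sin _) d1.
  apply: (is_derive_eq (is_deriveZ (Num.sqrt 2 / (m%:R * pi)) d2)).
  by rewrite /GRing.scale/= [cos _ * _]mulrC mulrA divfK// mulf_neq0.
rewrite (Rintegral_antiderivative R _ _ _ _ _ _ dF)//.
  by rewrite mulr1 sin_m !mulr0 sin0 mulr0 subr0.
move=> x; apply: cvgM; first exact: cvg_cst.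
apply: (@continuous_comp _ _ _ (fun x => m%:R * pi * x) cos).
  by apply: cvgM; [exact: cvg_cst|exact: cvg_id].
exact: continuous_cos.
Qed.

Lemma poincare_quadrature_exact n (X w : 'I_n -> R) : poincare_quadrature X w ->
  forall m, (m < 2 * n)%N ->
  \sum_(i < n) w i * cos (m%:R * (pi * X i)) = (m == 0%N)%:R.
Proof.
move=> [_ _ ex] m mn; have := ex m mn; rewrite Rintegral_poincare_basis.
rewrite /poincare_basis; case: eqVneq => [->|m0] h.
  by rewrite -[RHS]h; apply: eq_bigr => i _; rewrite mul0r cos0.
have s2 : Num.sqrt 2 != 0 :> R by rewrite sqrtr_eq0 -ltNge.
apply: (mulfI s2); rewrite mulr0 -[RHS]h mulr_sumr.
by apply: eq_bigr => i _; rewrite mulrCA -[m%:R * pi * _]mulrA.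
Qed.

(** The nodes are n distinct elements of the n-element set of midpoints, hence a
    permutation of it. *)
Lemma poincare_quadrature_midpoint n (X w : 'I_n -> R) : (0 < n)%N ->
  poincare_quadrature X w ->
  (forall i, w i = n%:R^-1) /\
  exists2 s : 'I_n -> 'I_n, injective s & forall i, X i = midpoint n (s i).
Proof.
move=> n0 P; have ex := poincare_quadrature_exact _ _ _ P.
have [X01 w0 _] := P; split => [i|].
  exact: (exact_quadrature_weights _ _ (fun i => pi * X i)).
have nodes i : exists k : 'I_n, X i = midpoint n k.
  apply: cos_natpi_zero => //.
  exact: (exact_quadrature_nodes _ _ (fun i => pi * X i) w).
have [s sE] := choice nodes; exists s => // i j sij.
by apply: (exact_quadrature_inj _ _ (fun i => pi * X i) w n0 ex); rewrite !sE sij.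
Qed.

Lemma wce_poincare_le n (X w : 'I_n -> R) : (0 < n)%N -> poincare_quadrature X w ->
  (wce X w <= (Num.sqrt (12 * n%:R ^+ 2)^-1)%:E)%E.
Proof.
move=> n0 P; have [wE [s injs XE]] := poincare_quadrature_midpoint _ _ _ n0 P.
apply: ge_ereal_sup => _ [h [g hg hg1] <-]; rewrite lee_fin.
have nR : 0 < n%:R :> R by rewrite ltr0n.
rewrite -sqrtr_sqr ler_wsqrtr//.
apply: le_trans (quadrature_error_bound _ _ X w _ _ _ _ hg hg1) _.
- move=> i; rewrite XE /midpoint divr_gt0 ?ltr0n ?double_gt0//=.
  by rewrite ltr_pdivrMr ?ltr0n ?double_gt0// mul1r ltr_nat; have := ltn_ord (s i); lia.
- have := poincare_quadrature_exact _ _ _ P 0%N; rewrite muln_gt0/= => /(_ n0) h0; rewrite -[RHS]h0.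
  by apply: eq_bigr => i _; rewrite mul0r cos0 mulr1.
rewrite -midpoint_kernel_sum//.
rewrite [leRHS](reindex_inj injs)/=.
rewrite le_eqVlt; apply/orP; left; apply/eqP; apply: eq_bigr => i _.
rewrite [RHS](reindex_inj injs)/=; apply: eq_bigr => j _.
by rewrite !wE !XE.
Qed.

End UpperBound.

(** * Parabolic arches *)

Section Arch.
Variable R : realType.
Notation mu := (@lebesgue_measure R).
Notation I01 := (`[0, 1]%classic : set R).

(** The values of f at c and d are left free because the derivative of an arch
    jumps at an end of its gap inside [0, 1], whereas it agrees with the polynomial
    at 0 or 1 when the gap extends beyond. *)
Lemma Rintegral_gap (f p : R -> R) (c d : R) : 0 <= c -> c <= d -> d <= 1 ->
  measurable_fun I01 f -> continuous p ->
  (forall x, c < x < d -> f x = p x) ->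
  (forall x, 0 <= x <= 1 -> (x < c) || (d < x) -> f x = 0) ->
  \int[mu]_(x in `[0, 1]) f x = \int[mu]_(x in `[c, d]) p x.
Proof.
move=> c0 cd d1 mf cp fp f0.
have mI : measurable I01 by exact: measurable_itv.
transitivity (\int[mu]_(x in `[0, 1]) (p \_ `[c, d]) x); last first.
  rewrite Rintegral_mkcond [RHS]Rintegral_mkcond; apply: eq_Rintegral => x _.
  rewrite !patchE !mem_setE !in_itv/=.
  case: ifPn => // h; case: ifPn => // /andP[cx xd].
  by move: h; rewrite (le_trans c0 cx) (le_trans xd d1).
congr fine; apply: ae_eq_integral => //.
- by apply/measurable_EFinP; exact: mf.
- apply/measurable_EFinP.
  apply: (@measurable_funS _ _ _ _ setT) => //.
  apply/(measurable_restrictT p) => //; apply: measurable_funTS.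
  exact: continuous_measurable_fun.
exists [set c; d]; split.
- by apply: measurableU; exact: measurable_set1.
- rewrite measureU0//; last exact: lebesgue_measure_set1.
  exact: lebesgue_measure_set1.
move=> x /= /not_implyP[]; rewrite in_itv/= => x01 h.
apply: contrapT => /not_orP[/eqP xc /eqP xd]; apply: h.
rewrite patchE mem_setE in_itv/=; congr (_%:E).
case: ifPn => [/andP[cx dx]|].
  by apply: fp; rewrite !lt_neqAle cx dx xd eq_sym xc.
by rewrite negb_and -!ltNge => h; rewrite f0.
Qed.

(** The solution of u'' = -1 with u a = u b = 0, which maximizes 2 int u - int u'^2
    among the functions on [a, b] with these boundary values. *)
Definition parabola (a b x : R) : R := (x - a) * (b - x) / 2.
Definition slope (a b x : R) : R := (a + b) / 2 - x.
Definition arch (a b x : R) : R := Num.max 0 (parabola a b x).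
Definition darch (a b x : R) : R := if a < x < b then slope a b x else 0.

Lemma is_derive_parabola a b (x : R) : is_derive x 1 (parabola a b) (slope a b x).
Proof.
have d1 : is_derive x 1 (fun y : R => y - a) (1 - 0).
  by apply: is_deriveB; exact: is_derive_id.
have d2 : is_derive x 1 (fun y : R => b - y) (0 - 1).
  by apply: is_deriveB; exact: is_derive_id.
have d3 := is_deriveM d1 d2.
have d4 := is_deriveZ (2^-1 : R) d3.
have -> : parabola a b = 2^-1 *: ((fun y : R => y - a) * (fun y : R => b - y)).
  by apply/funext => y; rewrite /parabola /GRing.scale/= mulrC.
by apply: (is_derive_eq d4); rewrite /slope /GRing.scale/=; field.
Qed.

Lemma continuous_sqr (f : R -> R) : continuous f -> continuous (fun x => f x ^+ 2).
Proof.
move=> cf; rewrite (_ : (fun x => _) = (fun x => f x * f x)); last first.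
  by apply/funext => x; rewrite expr2.
by move=> x; apply: cvgM; exact: cf.
Qed.

Lemma continuous_parabola a b : continuous (parabola a b).
Proof. exact: (is_derive_continuous _ _ _ (is_derive_parabola a b)). Qed.

Lemma continuous_slope a b : continuous (slope a b).
Proof. by move=> x; apply: cvgB; [exact: cvg_cst|exact: cvg_id]. Qed.

Lemma continuous_arch a b : continuous (arch a b).
Proof.
by move=> x; apply: continuous_max; [exact: cvg_cst|exact: continuous_parabola].
Qed.

Lemma archE a b x : a <= x <= b -> arch a b x = parabola a b x.
Proof.
move=> /andP[ax xb]; apply/max_idPr.
by rewrite divr_ge0// mulr_ge0// subr_ge0.
Qed.

Lemma arch_out a b x : a <= b -> (x <= a) || (b <= x) -> arch a b x = 0.
Proof.
move=> ab h; apply/max_idPl; rewrite /parabola.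
rewrite ler_pdivrMr// mul0r; case/orP: h => h.
  by rewrite mulr_le0_ge0// ?subr_le0 ?subr_ge0// (le_trans h).
by rewrite mulr_ge0_le0// ?subr_le0 ?subr_ge0// (le_trans _ h).
Qed.

Lemma darch_out a b x : (x <= a) || (b <= x) -> darch a b x = 0.
Proof.
rewrite /darch => /orP[h|h].
  by rewrite (ltNge a) h.
by rewrite (ltNge x) h andbF.
Qed.

Lemma measurable_darch a b (D : set R) : measurable D -> measurable_fun D (darch a b).
Proof.
move=> mD; apply: measurable_funTS; apply: measurable_fun_ifT.
- apply: measurable_and => //; exact: measurable_fun_ltr.
- by apply: continuous_measurable_fun; exact: continuous_slope.
- exact: measurable_cst.
Qed.

(** A function with a bounded weak derivative: a subspace of the pairs in [H1]
    that is plainly closed under sums and multiples, because every integrand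
    involved is bounded. *)
Definition weak_pair (h g : R -> R) : Prop :=
  [/\ continuous h, measurable_fun I01 g,
      exists M : R, forall x, 0 <= x <= 1 -> `|g x| <= M & weak_derivative h g].

Lemma test_function_derive (phi : R -> R) : test_function phi ->
  [/\ forall x : R, is_derive x 1 phi ((phi^`())%classic x),
      continuous (phi^`())%classic, phi 0 = 0 & phi 1 = 0].
Proof.
move=> [sm [a [b [a0 b1 supp]]]].
have d0 (x : R) : is_derive x 1 phi ((phi^`())%classic x).
  by rewrite derive1E; apply: DeriveDef => //; exact: (sm 0%N x).
have d1 (x : R) : is_derive x 1 ((phi^`())%classic) ((phi^`(2))%classic x).
  by rewrite derive1nS derive1E; apply: DeriveDef => //; exact: (sm 1%N x).
split=> //; first exact: (is_derive_continuous _ _ _ d1).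
  by apply: contraTeq a0 => /supp/andP[h _]; rewrite -leNgt.
by apply: contraTeq b1 => /supp/andP[_ h]; rewrite -leNgt.
Qed.

(** Here [a, b] may exceed [0, 1]: at each end of the intersection either the
    parabola vanishes or the test function does, so integration by parts leaves no
    boundary term. *)
Lemma weak_pair_arch a b : a <= b -> Num.max a 0 <= Num.min b 1 ->
  weak_pair (arch a b) (darch a b).
Proof.
move=> ab cd; split.
- exact: continuous_arch.
- exact: measurable_darch.
- exists (`|(a + b) / 2| + 1) => x /andP[x0 x1]; rewrite /darch; case: ifP => _.
    by rewrite (le_trans (ler_normB _ _))// lerD2l ger0_norm.
  by rewrite normr0 addr_ge0.
move=> phi tphi; have [dphi cphi' phi0 phi1] := test_function_derive _ tphi.
have cphi := is_derive_continuous _ _ _ dphi.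
set c := Num.max a 0 in cd *; set d := Num.min b 1 in cd *.
have c0 : 0 <= c by rewrite le_max lexx orbT.
have ac : a <= c by rewrite le_max lexx.
have d1 : d <= 1 by rewrite ge_min lexx orbT.
have db : d <= b by rewrite ge_min lexx.
have out x : 0 <= x <= 1 -> (x < c) || (d < x) -> (x <= a) || (b <= x).
  move=> /andP[x0 x1] /orP[]; rewrite /c /d.
    by rewrite lt_max (ltNge x 0) x0 orbF => /ltW ->.
  by rewrite gt_min (ltNge 1 x) x1 orbF => /ltW ->; rewrite orbT.
have mI : measurable I01 by exact: measurable_itv.
rewrite (@Rintegral_gap _ (fun x => parabola a b x * (phi^`())%classic x) c d)//; last 4 first.
- apply: measurable_funTS; apply: continuous_measurable_fun => x.
  by apply: cvgM; [exact: continuous_arch|exact: cphi'].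
- by move=> x; apply: cvgM; [exact: continuous_parabola|exact: cphi'].
- move=> x /andP[cx xd]; rewrite archE// (le_trans ac (ltW cx))/=.
  exact: le_trans (ltW xd) db.
- by move=> x x01 h; rewrite arch_out ?mul0r//; exact: out.
rewrite (@Rintegral_gap (fun x => darch a b x * phi x) (fun x => slope a b x * phi x) c d)//; last 4 first.
- apply: measurable_funM; first exact: measurable_darch.
  by apply: measurable_funTS; exact: continuous_measurable_fun.
- by move=> x; apply: cvgM; [exact: continuous_slope|exact: cphi].
- by move=> x /andP[cx xd]; rewrite /darch (le_lt_trans ac cx) (lt_le_trans xd db).
- by move=> x x01 h; rewrite darch_out ?mul0r//; exact: out.
apply/eqP; rewrite -addr_eq0 -RintegralD//; last 2 first.
- apply: continuous_integrable; apply: continuous_subspaceT => x.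
  by apply: cvgM; [exact: continuous_parabola|exact: cphi'].
- apply: continuous_integrable; apply: continuous_subspaceT => x.
  by apply: cvgM; [exact: continuous_slope|exact: cphi].
have dP (x : R) : is_derive x 1 (fun x => parabola a b x * phi x)
   (parabola a b x * (phi^`())%classic x + slope a b x * phi x).
  apply: (is_derive_eq (is_deriveM (is_derive_parabola a b x) (dphi x))).
  by rewrite /GRing.scale/= [phi x * _]mulrC.
rewrite (Rintegral_antiderivative R _ _ _ _ cd _ dP); last first.
  move=> x; apply: cvgD; apply: cvgM; [exact: continuous_parabola|exact: cphi'|exact: continuous_slope|exact: cphi].
have -> : parabola a b c * phi c = 0.
  rewrite /c; case: (leP a 0) => _; first by rewrite phi0 mulr0.
  by rewrite /parabola subrr !mul0r.
have -> : parabola a b d * phi d = 0.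
  rewrite /d; case: (leP b 1) => _; last by rewrite phi1 mulr0.
  by rewrite /parabola subrr mulr0 !mul0r.
by rewrite subrr.
Qed.

Lemma weak_pair_integrable (h g : R -> R) : weak_pair h g ->
  [/\ mu.-integrable I01 (EFin \o h), mu.-integrable I01 (EFin \o (fun x => h x ^+ 2)),
      mu.-integrable I01 (EFin \o g) & mu.-integrable I01 (EFin \o (fun x => g x ^+ 2))].
Proof.
move=> [ch mg [M gM] _]; split.
- by apply: continuous_integrable; exact: continuous_subspaceT.
- by apply: continuous_integrable; apply: continuous_subspaceT; exact: continuous_sqr.
- exact: bounded_integrable_itv gM.
apply: (@bounded_integrable_itv _ _ _ _ (M ^+ 2)); first exact: measurable_funX.
by move=> x /gM h'; rewrite normrX lerXn2r ?nnegrE// (le_trans _ h').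
Qed.

Lemma weak_pair_H1 (h g : R -> R) : weak_pair h g -> H1 h g.
Proof.
move=> hg; have [_ i2 _ i4] := weak_pair_integrable _ _ hg.
case: hg => ch mg _ wd; split => //.
- exact: continuous_subspaceT.
- by split => //; apply: measurable_funTS; exact: continuous_measurable_fun.
Qed.

Lemma weak_pair_test_integrable (h g phi : R -> R) : weak_pair h g -> test_function phi ->
  mu.-integrable I01 (EFin \o (fun x => h x * (phi^`())%classic x)) /\
  mu.-integrable I01 (EFin \o (fun x => g x * phi x)).
Proof.
move=> [ch mg [M gM] _] tphi; have [dphi cphi' _ _] := test_function_derive _ tphi.
have cphi := is_derive_continuous _ _ _ dphi.
split.
  apply: continuous_integrable; apply: continuous_subspaceT => x.
  by apply: cvgM; [exact: ch|exact: cphi'].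
apply: (@bounded_integrableM _ _ _ _ M) => //.
by apply: continuous_integrable; exact: continuous_subspaceT.
Qed.

Lemma weak_pairD (h g h' g' : R -> R) : weak_pair h g -> weak_pair h' g' ->
  weak_pair (fun x => h x + h' x) (fun x => g x + g' x).
Proof.
move=> hg hg'; have [ch mg [M gM] wd] := hg; have [ch' mg' [M' gM'] wd'] := hg'.
split.
- by move=> x; apply: cvgD; [exact: ch|exact: ch'].
- exact: measurable_funD.
- exists (M + M') => x x01; apply: le_trans (ler_normD _ _) _.
  by rewrite lerD ?gM ?gM'.
move=> phi tphi.
have [i1 i2] := weak_pair_test_integrable _ _ _ hg tphi.
have [i1' i2'] := weak_pair_test_integrable _ _ _ hg' tphi.
under eq_Rintegral => x _ do rewrite mulrDl.
rewrite RintegralD// wd// wd'//.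
under [in RHS]eq_Rintegral => x _ do rewrite mulrDl.
by rewrite RintegralD// opprD.
Qed.

Lemma weak_pairZ (k : R) (h g : R -> R) : weak_pair h g ->
  weak_pair (fun x => k * h x) (fun x => k * g x).
Proof.
move=> hg; have [ch mg [M gM] wd] := hg.
split.
- by move=> x; apply: cvgM; [exact: cvg_cst|exact: ch].
- exact: measurable_funM.
- by exists (`|k| * M) => x x01; rewrite normrM ler_wpM2l// gM.
move=> phi tphi.
have [i1 i2] := weak_pair_test_integrable _ _ _ hg tphi.
under eq_Rintegral => x _ do rewrite -mulrA.
rewrite RintegralZl// wd//.
under [in RHS]eq_Rintegral => x _ do rewrite -mulrA.
by rewrite RintegralZl// mulrN.
Qed.

(** The quantity 2 A - N for A the integral of h and N the squared norm; unlike
    A^2 / N it is additive over functions with disjoint supports. *)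
Definition energy (h g : R -> R) : R :=
  \int[mu]_(x in `[0, 1]) (2 * h x - h x ^+ 2 - g x ^+ 2).

Lemma energyE (h g : R -> R) : weak_pair h g ->
  energy h g = 2 * \int[mu]_(x in `[0, 1]) h x -
    (\int[mu]_(x in `[0, 1]) (h x ^+ 2) + \int[mu]_(x in `[0, 1]) (g x ^+ 2)).
Proof.
move=> hg; have [i1 i2 i3 i4] := weak_pair_integrable _ _ hg.
have i5 : mu.-integrable I01 (EFin \o (fun x => 2 * h x)) by exact: EFin_integrableZ.
rewrite /energy RintegralB//; last exact: EFin_integrableB.
by rewrite RintegralB// RintegralZl// opprD addrA.
Qed.

Lemma energyD (h g h' g' : R -> R) : weak_pair h g -> weak_pair h' g' ->
  (forall x, h x * h' x = 0) -> (forall x, g x * g' x = 0) ->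
  energy (fun x => h x + h' x) (fun x => g x + g' x) = energy h g + energy h' g'.
Proof.
move=> hg hg' hh gg.
have intE u v : weak_pair u v -> mu.-integrable I01 (EFin \o (fun x => 2 * u x - u x ^+ 2 - v x ^+ 2)).
  move=> uv; have [i1 i2 i3 i4] := weak_pair_integrable _ _ uv.
  apply: EFin_integrableB => //; apply: EFin_integrableB => //; exact: EFin_integrableZ.
rewrite /energy -RintegralD//; [|exact: intE..].
apply: eq_Rintegral => x _.
have -> : 2 * (h x + h' x) - (h x + h' x) ^+ 2 - (g x + g' x) ^+ 2 =
   2 * h x - h x ^+ 2 - g x ^+ 2 + (2 * h' x - h' x ^+ 2 - g' x ^+ 2)
   - 2 * (h x * h' x) - 2 * (g x * g' x) by ring.
by rewrite hh gg mulr0 !subr0.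
Qed.

(** In the coordinate s = x - m centred in the gap the integrand is the even
    polynomial r^2 - s^2 - (r^2 - s^2)^2 / 4 - s^2, and Q is its odd
    antiderivative. *)
Lemma energy_arch a b : a <= b -> Num.max a 0 <= Num.min b 1 ->
  let m := (a + b) / 2 in let r := (b - a) / 2 in
  let Q x := (r ^+ 2 - r ^+ 4 / 4) * (x - m) + (r ^+ 2 / 2 - 2) * ((x - m) ^+ 3 / 3)
             - 4^-1 * ((x - m) ^+ 5 / 5) in
  energy (arch a b) (darch a b) = Q (Num.min b 1) - Q (Num.max a 0).
Proof.
move=> ab cd m r Q; rewrite /energy.
set c := Num.max a 0 in cd *; set d := Num.min b 1 in cd *.
have c0 : 0 <= c by rewrite le_max lexx orbT.
have ac : a <= c by rewrite le_max lexx.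
have d1 : d <= 1 by rewrite ge_min lexx orbT.
have db : d <= b by rewrite ge_min lexx.
have out x : 0 <= x <= 1 -> (x < c) || (d < x) -> (x <= a) || (b <= x).
  move=> /andP[x0 x1] /orP[]; rewrite /c /d.
    by rewrite lt_max (ltNge x 0) x0 orbF => /ltW ->.
  by rewrite gt_min (ltNge 1 x) x1 orbF => /ltW ->; rewrite orbT.
have mI : measurable I01 by exact: measurable_itv.
pose q x := (r ^+ 2 - r ^+ 4 / 4) * 1 + (r ^+ 2 / 2 - 2) * (x - m) ^+ 2 - 4^-1 * (x - m) ^+ 4.
have dmon k (x : R) : is_derive x 1 (fun y : R => (y - m) ^+ k.+1 / k.+1%:R) ((x - m) ^+ k).
  have d1' : is_derive x 1 (fun y : R => y - m) (1 - 0).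
    by apply: is_deriveB; exact: is_derive_id.
  have := @is_derive1_comp _ (fun y : R => y ^+ k.+1 / k.+1%:R) (fun y : R => y - m) x _ _ (is_derive_monomial _ k _) d1'.
  by rewrite subr0 mulr1.
have dQ (x : R) : is_derive x 1 Q (q x).
  have d1' : is_derive x 1 (fun y : R => y - m) 1.
    by apply: (is_derive_eq (is_deriveB (is_derive_id x 1) (is_derive_cst m x 1))); rewrite subr0.
  exact: (is_deriveB (is_deriveD (is_deriveZ _ d1') (is_deriveZ _ (dmon 2 x))) (is_deriveZ 4^-1 (dmon 4 x))).
have cq : continuous q.
  have cx (x : R) : (y - m) @[y --> x] --> x - m by apply: cvgB; [exact: cvg_id|exact: cvg_cst].
  have ck k (x : R) : (y - m) ^+ k @[y --> x] --> (x - m) ^+ k.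
    by apply: (@continuous_comp _ _ _ (fun y => y - m) (fun y => y ^+ k)); [exact: cx|exact: exprn_continuous].
  move=> x; apply: cvgB; last by apply: cvgM; [exact: cvg_cst|exact: ck].
  by apply: cvgD; [exact: cvg_cst|apply: cvgM; [exact: cvg_cst|exact: ck]].
rewrite (@Rintegral_gap _ q c d)//; last 3 first.
- apply: measurable_funB; last by apply: measurable_funX; exact: measurable_darch.
  apply: measurable_funTS; apply: continuous_measurable_fun => x; apply: cvgB.
    by apply: cvgM; [exact: cvg_cst|exact: continuous_arch].
  exact: (continuous_sqr _ (continuous_arch a b)).
- move=> x /andP[cx xd].
  have ax := le_lt_trans ac cx; have xb := lt_le_trans xd db.
  rewrite /darch ax xb/= archE ?(ltW ax) ?(ltW xb)// /q /parabola /slope /m /r.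
  by field.
- by move=> x x01 h; rewrite arch_out ?darch_out//; [rewrite expr0n/=; ring|exact: out..].
by rewrite (Rintegral_antiderivative R _ _ _ _ cd cq dQ).
Qed.

End Arch.

(** * The lower bound for an arbitrary quadrature *)

Section LowerBound.
Variable R : realType.
Notation mu := (@lebesgue_measure R).

(** The multiple of h by sqrt E / A has integral sqrt E, and its squared norm
    E N / A^2 is at most 1 because E = 2 A - N and (A - N)^2 >= 0.  Choosing this
    factor avoids dividing by N. *)
Lemma wce_ge_energy n (X w : 'I_n -> R) (h g : R -> R) : weak_pair R h g ->
  (forall i, h (X i) = 0) -> 0 < energy R h g ->
  ((Num.sqrt (energy R h g))%:E <= wce X w)%E.
Proof.
move=> hg hX E0; have EE := energyE _ _ _ hg.
set E := energy R h g in E0 EE *.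
set A := \int[mu]_(x in `[0, 1]) h x in EE.
set N := \int[mu]_(x in `[0, 1]) (h x ^+ 2) + \int[mu]_(x in `[0, 1]) (g x ^+ 2) in EE.
have N0 : 0 <= N by rewrite addr_ge0//; apply: Rintegral_ge0 => x _; exact: sqr_ge0.
have A0 : 0 < A by lra.
have s0 : 0 <= Num.sqrt E by exact: sqrtr_ge0.
pose k := Num.sqrt E / A.
have khg := weak_pairZ _ k _ _ hg.
have [i1 i2 i3 i4] := weak_pair_integrable _ _ _ hg.
apply: ereal_sup_ubound; exists (fun x => k * h x).
  exists (fun x => k * g x); first exact: weak_pair_H1.
  rewrite /H1_norm.
  have sqE (f : R -> R) : mu.-integrable `[0, 1] (EFin \o (fun x => f x ^+ 2)) ->
      \int[mu]_(x in `[0, 1]) ((k * f x) ^+ 2) = k ^+ 2 * \int[mu]_(x in `[0, 1]) (f x ^+ 2).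
    by move=> i; under eq_Rintegral => x _ do rewrite exprMn; rewrite RintegralZl.
  rewrite !sqE// -mulrDr -/N -sqrtr1 ler_wsqrtr// /k expr_div_n sqr_sqrtr ?(ltW E0)//.
  rewrite mulrAC ler_pdivrMr ?exprn_gt0// mul1r EE.
  by have := sqr_ge0 (A - N); rewrite !expr2; nra.
rewrite RintegralZl// -/A /k divfK ?gt_eqF//.
by rewrite big1 ?subr0 ?ger0_norm// => i _; rewrite hX !mulr0.
Qed.

(** The arches over successive gaps have disjoint supports, so their energies
    add up; each new arch starts where the sum of the previous ones ends. *)
Lemma arch_chain (y : nat -> R) (n : nat) :
  (forall i, (i < n)%N -> y i <= y i.+1) ->
  (forall i, (i < n)%N -> Num.max (y i) 0 <= Num.min (y i.+1) 1) ->
  exists h g : R -> R, [/\ weak_pair R h g,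
    (forall x, y n <= x -> h x = 0 /\ g x = 0),
    (forall j, (j <= n)%N -> h (y j) = 0) &
    energy R h g = \sum_(i < n) energy R (arch R (y i) (y i.+1)) (darch R (y i) (y i.+1))].
Proof.
elim: n => [|n IH] ymono ygap.
  exists (fun=> 0), (fun=> 0); split => //.
  - split; [by move=> x; exact: cvg_cst|exact: measurable_cst| |].
      by exists 0 => x _; rewrite normr0.
    move=> phi _; under eq_Rintegral do rewrite mul0r.
    under [in RHS]eq_Rintegral do rewrite mul0r.
    by rewrite Rintegral_cst// mul0r oppr0.
  - rewrite big_ord0 /energy; under eq_Rintegral do rewrite mulr0 expr0n subr0 subr0.
    by rewrite Rintegral_cst// mul0r.
have [h [g [hg supp hy en]]] := IH (fun i ni => ymono i (ltnW ni)) (fun i ni => ygap i (ltnW ni)).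
have yn := ymono _ (ltnSn n).
have b := weak_pair_arch _ _ _ yn (ygap _ (ltnSn n)).
set u := arch R (y n) (y n.+1) in b *; set v := darch R (y n) (y n.+1) in b *.
have out x : x <= y n -> u x = 0 /\ v x = 0.
  by move=> xy; rewrite /u /v arch_out ?darch_out ?xy.
exists (fun x => h x + u x), (fun x => g x + v x); split.
- exact: weak_pairD.
- move=> x yx; have [-> ->] := supp x (le_trans yn yx).
  by rewrite /u /v arch_out ?darch_out ?yx ?orbT// addr0.
- move=> j; rewrite leq_eqVlt => /predU1P[->|jn].
    have [-> _] := supp _ yn.
    by rewrite /u arch_out ?lexx ?orbT// addr0.
  rewrite hy// add0r.
  suff /out[] : y j <= y n by [].
  have : forall k, (j <= k)%N -> (k <= n)%N -> y j <= y k.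
    elim=> [|k IHk]; first by rewrite leqn0 => /eqP ->.
    rewrite leq_eqVlt => /predU1P[->//|jk] kn.
    by rewrite (le_trans (IHk jk (ltnW kn)))// ymono// ltnS ltnW.
  by apply; rewrite -ltnS.
- rewrite energyD//; first by rewrite big_ord_recr/= en.
  + move=> x; have [/out[-> _]|/ltW/supp[-> _]] := leP x (y n); by rewrite ?mulr0 ?mul0r.
  + move=> x; have [/out[_ ->]|/ltW/supp[_ ->]] := leP x (y n); by rewrite ?mulr0 ?mul0r.
Qed.

Definition gap_value (d : R) : R := d ^+ 3 - d ^+ 5 / 10.

Definition gap_tangent (t d : R) : R :=
  gap_value t + (3 * t ^+ 2 - t ^+ 4 / 2) * (d - t).

(** The difference is (d - t)^2 times a factor that is nonnegative for d <= 2.  The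
    range up to 2 is what reflected outer gaps require; the function is not convex
    there. *)
Lemma gap_value_ge_tangent (t d : R) : 0 <= t <= 1 -> 0 <= d <= 2 ->
  gap_tangent t d <= gap_value d.
Proof.
move=> /andP[t0 t1] /andP[d0 d2]; rewrite -subr_ge0.
have -> : gap_value d - gap_tangent t d = (d - t) ^+ 2 *
   ((d + 2 * t) - (d ^+ 3 + 2 * d ^+ 2 * t + 3 * d * t ^+ 2 + 4 * t ^+ 3) / 10).
  by rewrite /gap_tangent /gap_value; field.
rewrite mulr_ge0 ?sqr_ge0// subr_ge0 ler_pdivrMr//.
have d24 : d ^+ 2 <= 4 by rewrite expr2; nra.
have t21 : t ^+ 2 <= 1 by rewrite expr2; nra.
have h1 : d ^+ 3 <= 4 * d by rewrite exprS mulrC ler_wpM2r.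
have h2 : d ^+ 2 * t <= 4 * t by rewrite ler_wpM2r.
have h3 : d * t ^+ 2 <= d by rewrite ler_piMr.
have h4 : t ^+ 3 <= t by rewrite exprS ler_piMr.
by lra.
Qed.

Lemma energy_arch_inner a b : 0 <= a -> a <= b -> b <= 1 ->
  energy R (arch R a b) (darch R a b) = gap_value (b - a) / 12.
Proof.
move=> a0 ab b1.
rewrite energy_arch//; last by rewrite (max_idPl a0) (min_idPl b1).
by rewrite (max_idPl a0) (min_idPl b1) /gap_value; field.
Qed.

Lemma energy_arch_left b : 0 <= b -> b <= 1 ->
  energy R (arch R (- b) b) (darch R (- b) b) = gap_value (2 * b) / 24.
Proof.
move=> b0 b1; have nb : - b <= 0 by rewrite oppr_le0.
rewrite energy_arch; last 2 first.
- exact: le_trans nb b0.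
- by rewrite (max_idPr nb) (min_idPl b1).
by rewrite (max_idPr nb) (min_idPl b1) /gap_value; field.
Qed.

Lemma energy_arch_right a : 0 <= a -> a <= 1 ->
  energy R (arch R a (2 - a)) (darch R a (2 - a)) = gap_value (2 * (1 - a)) / 24.
Proof.
move=> a0 a1; have na : 1 <= 2 - a by lra.
rewrite energy_arch; last 2 first.
- exact: le_trans a1 na.
- by rewrite (max_idPl a0) (min_idPr na).
by rewrite (max_idPl a0) (min_idPr na) /gap_value; field.
Qed.

(** The nodes are sorted, possibly with repetitions, and framed by the reflections
    of the smallest one at 0 and of the largest one at 1. *)
Lemma wce_lower_bound n (X w : 'I_n -> R) : (0 < n)%N -> nodes01 X ->
  ((Num.sqrt ((12 * n%:R ^+ 2)^-1 * (1 - (10 * n%:R ^+ 2)^-1)))%:E <= wce X w)%E.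
Proof.
case: n X w => // m X w _ X01.
set n := m.+1.
pose s := sort <=%R [seq X i | i <- enum 'I_n].
have size_s : size s = n by rewrite size_sort size_map size_enum_ord.
have s01 k : (k < n)%N -> 0 <= s`_k <= 1.
  move=> kn; have : s`_k \in s by rewrite mem_nth// size_s.
  by rewrite mem_sort => /mapP[i _ ->]; exact: X01.
have s_sorted : sorted <=%R s by exact: sort_le_sorted.
have smono k : (k.+1 < n)%N -> s`_k <= s`_k.+1.
  move=> kn; apply: (sorted_leq_nth le_trans le_refl 0 s_sorted) => //;
  by rewrite inE size_s// ltnW.
pose y k := if k is k'.+1 then (if (k' < n)%N then s`_k' else 2 - s`_m) else - s`_0.
have /andP[s00 s01_] := s01 0%N (ltn0Sn m).
have /andP[sm0 sm1] := s01 m (ltnSn m).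
have y0E : y 0%N = - s`_0 by [].
have ynE : y n.+1 = 2 - s`_m by rewrite /y ltnn.
have y1E k : (k < n)%N -> y k.+1 = s`_k by rewrite /y => ->.
have ymono i : (i < n.+1)%N -> y i <= y i.+1.
  case: i => [|i]; first by rewrite y1E// /y => _; rewrite (@le_trans _ _ 0)// oppr_le0.
  rewrite ltnS leq_eqVlt => /predU1P[[->]|iin].
    by rewrite ynE y1E//; lra.
  by rewrite y1E ?(ltnW iin)// y1E// smono.
have ygap i : (i < n.+1)%N -> Num.max (y i) 0 <= Num.min (y i.+1) 1.
  case: i => [|i].
    by rewrite y1E// y0E ge_max !le_min => _; apply/andP; split; apply/andP; split; lra.
  rewrite ltnS leq_eqVlt => /predU1P[[->]|iin].
    by rewrite ynE y1E// ge_max !le_min; apply/andP; split; apply/andP; split; lra.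
  rewrite !y1E ?(ltnW iin)// ge_max !le_min smono// ler01.
  have /andP[-> _] := s01 _ iin.
  by have /andP[_ ->] := s01 _ (ltnW iin).
have [h [g [hg _ hy en]]] := arch_chain _ _ ymono ygap.
set t : R := n%:R^-1.
have nR : 0 < n%:R :> R by rewrite ltr0n.
have t01 : 0 <= t <= 1 by rewrite invr_ge0 ltW//= invf_le1// ler1n.
have tn : t * n%:R = 1 by rewrite mulVf ?gt_eqF.
have /andP[t0 t1] := t01.
pose e i := energy R (arch R (y i) (y i.+1)) (darch R (y i) (y i.+1)).
have e0 : gap_tangent t (2 * s`_0) / 24 <= e 0%N.
  rewrite /e y1E// y0E energy_arch_left// ler_pM2r ?invr_gt0//.
  by apply: gap_value_ge_tangent => //; apply/andP; split; lra.
have em : gap_tangent t (2 * (1 - s`_m)) / 24 <= e m.+1.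
  rewrite /e ynE y1E// energy_arch_right// ler_pM2r ?invr_gt0//.
  by apply: gap_value_ge_tangent => //; apply/andP; split; lra.
have ei i : (i < m)%N -> gap_tangent t (s`_i.+1 - s`_i) / 12 <= e i.+1.
  move=> im; have iin : (i.+1 < n)%N by [].
  have si := smono _ iin.
  have /andP[_ i1] := s01 _ iin; have /andP[i0 _] := s01 _ (ltnW iin).
  rewrite /e !y1E ?(ltnW iin)// energy_arch_inner// ler_pM2r ?invr_gt0//.
  by apply: gap_value_ge_tangent => //; apply/andP; split; lra.
have esum : \sum_(i < m) gap_tangent t (s`_i.+1 - s`_i) =
    m%:R * gap_value t + (3 * t ^+ 2 - t ^+ 4 / 2) * (s`_m - s`_0 - m%:R * t).
  rewrite /gap_tangent big_split/= sumr_const card_ord -mulr_sumr big_split/=.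
  rewrite -(big_mkord xpredT (fun i => s`_i.+1 - s`_i)) telescope_sumr//.
  by rewrite sumr_const card_ord mulNrn !mulr_natl.
have E1 : n%:R * gap_value t / 12 <= energy R h g.
  rewrite en -(big_mkord xpredT e) big_nat_recl// big_nat_recr//= big_mkord.
  have : \sum_(i < m) gap_tangent t (s`_i.+1 - s`_i) / 12 <= \sum_(i < m) e i.+1.
    by apply: ler_sum => i _; exact: ei.
  rewrite -mulr_suml esum => esum'.
  have -> : n%:R * gap_value t / 12 = gap_tangent t (2 * s`_0) / 24 +
    ((m%:R * gap_value t + (3 * t ^+ 2 - t ^+ 4 / 2) * (s`_m - s`_0 - m%:R * t)) / 12 +
     gap_tangent t (2 * (1 - s`_m)) / 24).
    have mE : m%:R = n%:R - 1 :> R by rewrite /n -natr1 addrK.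
    have mt : m%:R * t = 1 - t by rewrite mE mulrBl mul1r [_ * t]mulrC tn.
    by rewrite mt mE /gap_tangent; field.
  by rewrite lerD// lerD.
have gE : n%:R * gap_value t / 12 = (12 * n%:R ^+ 2)^-1 * (1 - (10 * n%:R ^+ 2)^-1).
  by rewrite /gap_value /t; field; rewrite gt_eqF.
have g0 : 0 < n%:R * gap_value t / 12.
  rewrite gE mulr_gt0 ?invr_gt0 ?mulr_gt0 ?exprn_gt0// subr_gt0 invf_lt1 ?mulr_gt0 ?exprn_gt0//.
  have : 1 <= n%:R ^+ 2 :> R by rewrite exprn_ege1// ler1n.
  by lra.
rewrite -gE; apply: le_trans (wce_ge_energy _ _ _ _ _ hg _ (lt_le_trans g0 E1)).
  by rewrite lee_fin ler_wsqrtr.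
move=> i; have Xs : X i \in s by rewrite mem_sort map_f// mem_enum.
have kn : (index (X i) s < n)%N by rewrite -size_s index_mem.
rewrite -(nth_index 0 Xs) -y1E//.
by rewrite hy// ltnS ltnW.
Qed.

End LowerBound.

(** * Asymptotic optimality *)

Theorem mainTheorem8 (R : realType) (X w : forall n : nat, 'I_n -> R)
  (hP : forall n : nat, (1 <= n)%N -> poincare_quadrature (X n) (w n)) :
  (wce (X n) (w n) / radius_of_information R n)%E @[n --> \oo] --> 1%E.
Proof.
pose q (n : nat) : R := 1 - (10 * n%:R ^+ 2)^-1.
have q_cvg : (Num.sqrt (q n))^-1 @[n --> \oo] --> (1 : R).
  have inv0 : (n%:R^-1 : R) @[n --> \oo] --> (0 : R).
    by apply/gtr0_cvgV0; [near=> n; rewrite ltr0n; near: n; exact: nbhs_infty_gt|exact: cvgr_idn].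
  have q1 : q n @[n --> \oo] --> (1 : R).
    rewrite -[X in _ --> X]subr0; apply: cvgB; first exact: cvg_cst.
    have -> : (fun n : nat => (10 * n%:R ^+ 2)^-1) = (fun n : nat => 10^-1 * (n%:R^-1 * n%:R^-1)) :> (nat -> R).
      by apply/funext => n; rewrite invfM -exprVn expr2.
    rewrite -[X in _ --> X](mulr0 10^-1); apply: cvgM; first exact: cvg_cst.
    by rewrite -[X in _ --> X](mulr0 0); apply: cvgM.
  rewrite -[X in _ --> X]invr1; apply: cvgV; first exact: oner_neq0.
  rewrite -[X in _ --> X](sqrtr1 R); apply: continuous_cvg => //.
  exact: sqrt_continuous.
apply: (@squeeze_cvge _ _ _ _ (cst 1%E) _ (fun n => ((Num.sqrt (q n))^-1)%:E)); last 2 first.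
- exact: cvg_cst.
- by apply: cvg_EFin; [exact: nearW|exact: q_cvg].
near=> n.
have n0 : (0 < n)%N by near: n; exact: nbhs_infty_gt.
have nR : 0 < n%:R :> R by rewrite ltr0n.
have P := hP n n0.
set c : R := (12 * n%:R ^+ 2)^-1.
have c0 : 0 < c by rewrite invr_gt0 mulr_gt0// exprn_gt0.
have q0 : 0 < q n.
  rewrite subr_gt0 invf_lt1 ?mulr_gt0 ?exprn_gt0//.
  have : 1 <= n%:R ^+ 2 :> R by rewrite exprn_ege1// ler1n.
  by lra.
have upper : (wce (X n) (w n) <= (Num.sqrt c)%:E)%E by exact: wce_poincare_le.
have lower : ((Num.sqrt (c * q n))%:E <= radius_of_information R n)%E.
  by apply: le_ereal_inf_tmp => _ [Y [v [Y01 ->]]]; exact: wce_lower_bound.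
have rw : (radius_of_information R n <= wce (X n) (w n))%E.
  by apply: ereal_inf_lbound; exists (X n), (w n); split => //; case: P.
move: upper lower rw.
case: (wce (X n) (w n)) => [a||]; case: (radius_of_information R n) => [b||] //.
rewrite !lee_fin => ac cb ba.
have cq0 : 0 < Num.sqrt (c * q n) by rewrite sqrtr_gt0 mulr_gt0.
have b0 : 0 < b := lt_le_trans cq0 cb.
rewrite inver gt_eqF// -EFinM !lee_fin ler_pdivlMr// mul1r ba/=.
rewrite ler_pdivrMr// ler_pdivlMl ?sqrtr_gt0//.
rewrite (le_trans _ cb)// (sqrtrM _ (ltW c0)) mulrC ler_wpM2r//.
Unshelve. all: by end_near. Qed.
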